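(* For every $n\in\mathbb{Z}_{>0}$, let $\boldsymbol{\sigma}^n$ be a uniform random permutation in $\mathrm{Av}^n(321)$. There exists a random infinite rooted permutation $\boldsymbol{\sigma}^\infty_{321}$ such that $(\boldsymbol{\sigma}^n)$ converges in the quenched Benjamini--Schramm sense to the (deterministic) measure $\mathcal{L}(\boldsymbol{\sigma}^\infty_{321})$, the law of $\boldsymbol{\sigma}^\infty_{321}$.
   Context: All intervals $[a,b]$ are integer intervals. $\mathcal{S}^n$ is the set of permutations $\sigma=\sigma_1\cdots\sigma_n$ of $[n]=\{1,\dots,n\}$, $|\sigma|=n$ is the size, and $\mathcal{S}=\bigcup_{n\ge1}\mathcal{S}^n$. $\mathrm{Av}^n(321)$ is the set of permutations in $\mathcal{S}^n$ having no decreasing subsequence of length $3$. Rooted permutations. A finite rooted permutation is a pair $(\sigma,i)$ with $\sigma\in\mathcal{S}^n$, $i\in[n]$. It is identified with the pair $(A_{\sigma,i},\preccurlyeq_{\sigma,i})$, where $A_{\sigma,i}=[-i+1,|\sigma|-i]$ and $\preccurlyeq_{\sigma,i}$ is the total order on it given by $\ell\preccurlyeq_{\sigma,i}j\iff\sigma_{\ell+i}\le\sigma_{j+i}$; this is a bijection between finite rooted permutations and total orders on finite integer intervals containing $0$. An infinite rooted permutation is a pair $(A,\preccurlyeq)$ with $A$ an infinite integer interval containing $0$ and $\preccurlyeq$ a total order on $A$. $\tilde{\mathcal{S}}_\bullet$ is the set of all finite and infinite rooted permutations. For $h\in\mathbb{Z}_{>0}$, $r_h(A,\preccurlyeq)=(A\cap[-h,h],\preccurlyeq)$.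 The local distance on $\tilde{\mathcal{S}}_\bullet$ is $d(x,y)=2^{-\sup\{h\in\mathbb{Z}_{>0}:\,r_h(x)=r_h(y)\}}$, with $\sup\emptyset=0$, $\sup\mathbb{Z}_{>0}=+\infty$, $2^{-\infty}=0$. Quenched convergence: for a permutation $\sigma$, let $\mu_\sigma$ be the law of $(\sigma,\boldsymbol{i})$ with $\boldsymbol{i}$ uniform in $[|\sigma|]$, a probability measure on $\tilde{\mathcal{S}}_\bullet$. A sequence $(\boldsymbol{\sigma}^n)$ of random permutations converges in the quenched Benjamini--Schramm sense to a (possibly random) probability measure $\boldsymbol{\mu}$ on $\tilde{\mathcal{S}}_\bullet$ if the random measures $\mu_{\boldsymbol{\sigma}^n}$ converge in distribution to $\boldsymbol{\mu}$ with respect to the weak topology on probability measures on $(\tilde{\mathcal{S}}_\bullet,d)$. *)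

(* Defs.v *)
From HB Require Import structures.
From mathcomp Require Import all_boot all_order all_algebra all_fingroup.
From mathcomp Require Import all_classical all_reals all_analysis.
From mathcomp Require Import zify.

Set Implicit Arguments.
Unset Strict Implicit.
Unset Printing Implicit Defensive.
Import Order.TTheory GRing.Theory Num.Theory.
Import numFieldNormedType.Exports.
Local Open Scope classical_set_scope.
Local Open Scope ring_scope.

(* The set of permutations of all sizes n >= 1, with the discrete
   sigma-algebra; 'S_n.+1 permutes {0, ..., n}. *)
Definition perms : Type := {n : nat & 'S_n.+1}.

Definition to_perms n (s : 'S_n.+1) : perms := Tagged (fun n => 'S_n.+1) s.

HB.instance Definition _ := Choice.on perms.
HB.instance Definition _ := isPointed.Build perms (to_perms (1%g : 'S_1)).
HB.instance Definition _ := @isMeasurable.Build default_measure_display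
  perms discrete_measurable discrete_measurable0
  discrete_measurableC discrete_measurableU.

Definition Av321 n : {set 'S_n} :=
  [set s : 'S_n | ~~ [exists i : 'I_n, [exists j : 'I_n, [exists k : 'I_n,
     [&& (i < j)%N, (j < k)%N, (s j < s i)%N & (s k < s j)%N]]]]].

Definition uniform_on (R : realType) d (Omega : measurableType d)
    (P : probability Omega R) (sigma : {RV P >-> perms}) n
    (A : {set 'S_n.+1}) : Prop :=
  forall B : set perms, distribution P sigma B =
    (#|[set s in A | to_perms s \in B]|%:R / #|A|%:R)%:E.

Arguments uniform_on {R d Omega} P sigma {n} A.

(* A total order on an integer interval, finite or not, that contains 0. The
   relation is required to hold only between elements of the interval, so that
   equality in this type is equality of pairs (interval, order on it). *)
Record rooted_perm := RootedPerm {
  rdom : set int ;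
  rle : int -> int -> Prop ;
  rdom0 : rdom 0 ;
  rdom_itv : is_interval rdom ;
  rle_dom : forall x y, rle x y -> rdom x /\ rdom y ;
  rle_refl : forall x, rdom x -> rle x x ;
  rle_anti : forall x y, rle x y -> rle y x -> x = y ;
  rle_trans : forall y x z, rle x y -> rle y z -> rle x z ;
  rle_total : forall x y, rdom x -> rdom y -> rle x y \/ rle y x }.

HB.instance Definition _ := gen_eqMixin rooted_perm.
HB.instance Definition _ := gen_choiceMixin rooted_perm.

Lemma rooted_permP (x y : rooted_perm) :
  rdom x = rdom y -> rle x = rle y -> x = y.
Proof.
case: x y => [A r ? ? ? ? ? ? ?] [B s ? ? ? ? ? ? ?] /= AB rs.
by subst B s; congr RootedPerm; exact: Prop_irrelevance.
Qed.

Definition infinite_rooted (x : rooted_perm) : Prop := infinite_set (rdom x).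

Section finite_rooted.
Variables (n : nat) (s : 'S_n.+1) (i : 'I_n.+1).

(* With a root i counted from 0, the interval [-(i+1)+1, (n+1)-(i+1)] is
   [-i, n-i]. *)
Let A : set int := [set l | - i%:Z <= l <= n%:Z - i%:Z].
Let le (l j : int) := exists a b : 'I_n.+1,
  [/\ a%:Z = l + i%:Z, b%:Z = j + i%:Z & (s a <= s b)%N].

Let A0 : A 0.
Proof. by rewrite /A /=; have := ltn_ord i; lia. Qed.

Let A_itv : is_interval A.
Proof. by move=> x y; rewrite /A /= => ? ? z; lia. Qed.

Let le_A x y : le x y -> A x /\ A y.
Proof.
move=> [a [b [ea eb _]]]; rewrite /A /=.
by have := ltn_ord a; have := ltn_ord b; lia.
Qed.

Let A_ord x : A x -> exists a : 'I_n.+1, a%:Z = x + i%:Z.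
Proof.
rewrite /A /= => Ax; have xn : (`|(x + i%:Z)%R| < n.+1)%N by lia.
by exists (Ordinal xn) => /=; lia.
Qed.

Let le_refl x : A x -> le x x.
Proof. by move=> /A_ord[a ea]; exists a, a. Qed.

Let le_anti x y : le x y -> le y x -> x = y.
Proof.
move=> [a [b [ea eb ab]]] [b' [a' [eb' ea' ba]]].
have ? : a' = a by apply/val_inj => /=; lia.
have ? : b' = b by apply/val_inj => /=; lia.
subst a' b'; have /val_inj/perm_inj eab : val (s a) = val (s b).
  by apply/eqP; rewrite eqn_leq ab ba.
by move: ea eb; rewrite eab; lia.
Qed.

Let le_trans y x z : le x y -> le y z -> le x z.
Proof.
move=> [a [b [ea eb ab]]] [b' [c [eb' ec bc]]].
have ? : b' = b by apply/val_inj => /=; lia.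
by subst b'; exists a, c; split => //; exact: leq_trans ab bc.
Qed.

Let le_total x y : A x -> A y -> le x y \/ le y x.
Proof.
move=> /A_ord[a ea] /A_ord[b eb]; case/orP: (leq_total (s a) (s b)) => ab.
- by left; exists a, b.
- by right; exists b, a.
Qed.

Definition finite_rooted : rooted_perm :=
  RootedPerm A0 A_itv le_A le_refl le_anti le_trans le_total.

End finite_rooted.

HB.instance Definition _ :=
  isPointed.Build rooted_perm (finite_rooted (1%g : 'S_1) ord0).

Section restriction.
Variables (h : nat) (x : rooted_perm).

Let A : set int := rdom x `&` [set l | - h%:Z <= l <= h%:Z].
Let le (l j : int) := [/\ A l, A j & rle x l j].

Let A0 : A 0.
Proof. by split; [exact: rdom0 | rewrite /=; lia]. Qed.

Let A_itv : is_interval A.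
Proof.
move=> a b [xa /= ha] [xb /= hb] c acb; split; first exact: rdom_itv acb.
by rewrite /=; lia.
Qed.

Let le_A l j : le l j -> A l /\ A j. Proof. by case. Qed.

Let le_refl l : A l -> le l l.
Proof. by move=> Al; split => //; apply: rle_refl; case: Al. Qed.

Let le_anti l j : le l j -> le j l -> l = j.
Proof. by move=> [_ _ +] [_ _ +]; exact: rle_anti. Qed.

Let le_trans j l k : le l j -> le j k -> le l k.
Proof. by move=> [? ? lj] [? ? jk]; split => //; exact: rle_trans lj jk. Qed.

Let le_total l j : A l -> A j -> le l j \/ le j l.
Proof.
move=> Al Aj; case: (rle_total (proj1 Al) (proj1 Aj)) => ?.
- by left.
- by right.
Qed.

Definition restr : rooted_perm :=
  RootedPerm A0 A_itv le_A le_refl le_anti le_trans le_total.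

End restriction.

Lemma restr_restr h k x : (h <= k)%N -> restr h (restr k x) = restr h x.
Proof.
move=> hk; have dE : rdom (restr h (restr k x)) = rdom (restr h x).
  apply/seteqP; split => l /=; first by move=> [[? ?] ?].
  by move=> [? lh]; do 2 split => //; lia.
apply: rooted_permP => //; apply/funext => l; apply/funext => j.
rewrite propeqE; split => /=.
- by move=> [[[? _] ?] [[? _] ?] [_ _ ?]].
- move=> [[xl lh] [xj jh] lj].
  have lk : rdom (restr k x) l by split => //=; lia.
  have jk : rdom (restr k x) j by split => //=; lia.
  by split.
Qed.

Section local_distance.
Variable R : realType.
Implicit Types x y z : rooted_perm.

(* ereal_sup set0 = -oo, hence the maximum with 0. *)
Definition agreement x y : \bar R :=
  Order.max 0%E (ereal_sup [set h%:R%:E | h in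
    [set h : nat | (0 < h)%N /\ restr h x = restr h y]]).

(* The value at -oo is never used, as agreement is nonnegative. *)
Definition exp2N (s : \bar R) : R :=
  match s with
  | r%:E => 2 `^ (- r)
  | +oo%E => 0
  | -oo%E => 0
  end.

Definition local_dist x y : R := exp2N (agreement x y).

Lemma agreement_ge0 x y : (0 <= agreement x y)%E.
Proof. by rewrite /agreement le_max lexx. Qed.

Lemma agreement_ge x y h :
  (0 < h)%N -> restr h x = restr h y -> (h%:R%:E <= agreement x y)%E.
Proof.
move=> h0 xy; rewrite /agreement le_max; apply/orP; right.
by apply: ereal_sup_ubound; exists h.
Qed.

Lemma agreement_gt x y (r : R) : 0 <= r -> (r%:E < agreement x y)%E ->
  exists h : nat, [/\ (0 < h)%N, r < h%:R & restr h x = restr h y].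
Proof.
move=> r0; rewrite /agreement lt_max lte_fin => /orP[|].
  by move=> /(le_lt_trans r0); rewrite ltxx.
by move=> /ereal_sup_gt[_ [h [h0 hxy] <-]]; rewrite lte_fin; exists h.
Qed.

Lemma exp2N_le (a b : \bar R) : (0 <= a)%E -> (a <= b)%E -> exp2N b <= exp2N a.
Proof.
case: a b => [a| |] [b| |] //=; rewrite ?lee_fin => a0 ab.
by rewrite ler_powR ?lerN2// ler1n.
Qed.

Lemma exp2N_ge0 (a : \bar R) : 0 <= exp2N a.
Proof. by case: a => [a| |] //=; exact: powR_ge0. Qed.

Lemma local_distxx x : local_dist x x = 0.
Proof.
rewrite /local_dist; suff -> : agreement x x = +oo%E by [].
apply/eqyP => r r0; apply: (@le_trans _ _ (Num.bound r).+1%:R%:E).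
  rewrite lee_fin (le_trans (ltW (archi_boundP (ltW r0))))//.
  by rewrite ler_nat.
exact: agreement_ge.
Qed.

Lemma local_dist_sym x y : local_dist x y = local_dist y x.
Proof.
rewrite /local_dist /agreement; congr (exp2N (Order.max _ (ereal_sup _))).
by apply/seteqP; split => _ [h [h0 xy] <-]; exists h.
Qed.

Lemma local_dist_positivity x y : local_dist x y = 0 -> x = y.
Proof.
move=> xy; have aoo : agreement x y = +oo%E.
  move: xy (agreement_ge0 x y); rewrite /local_dist.
  case: (agreement x y) => [r| |] //= /eqP; rewrite powR_eq0.
  by rewrite pnatr_eq0.
have agr (k : nat) : restr k x = restr k y.
  have [|h [_ kh hxy]] := @agreement_gt x y k%:R (ler0n _ _).
    by rewrite aoo ltey.
  have {}kh : (k <= h)%N by rewrite ltnW// -(ltr_nat R).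
  by rewrite -(restr_restr x kh) hxy restr_restr.
have domE l : rdom x l = rdom y l.
  have := congr1 (fun w => rdom w l) (agr `|l|%N); rewrite propeqE => /= -[xy1 yx1].
  have ll : - (`|l|%N)%:Z <= l <= (`|l|%N)%:Z by lia.
  by rewrite propeqE; split => H;
    [have [] := xy1 (conj H ll)|have [] := yx1 (conj H ll)].
apply: rooted_permP; first by apply/funext => l.
apply/funext => l; apply/funext => j.
have := congr1 (fun w => rle w l j) (agr (`|l| + `|j|)%N).
have ll : - (`|l| + `|j|)%N%:Z <= l <= (`|l| + `|j|)%N%:Z by lia.
have jj : - (`|l| + `|j|)%N%:Z <= j <= (`|l| + `|j|)%N%:Z by lia.
rewrite !propeqE => /= -[xy1 yx1]; split => lj; have [dl dj] := rle_dom lj.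
- by have [] := xy1 (And3 (conj dl ll) (conj dj jj) lj).
- by have [] := yx1 (And3 (conj dl ll) (conj dj jj) lj).
Qed.

Lemma local_dist_triangle y x z :
  local_dist x z <= local_dist x y + local_dist y z.
Proof.
have [h|h] : (agreement x y <= agreement x z)%E \/
             (agreement y z <= agreement x z)%E.
  apply/orP.
  apply: contraT; rewrite negb_or -!ltNge => /andP[].
  have := agreement_ge0 x z; case E : (agreement x z) => [r| |] // r0 hxy hyz;
    last by move: hxy; rewrite ltNge leey.
  have [h [h0 rh eh]] := agreement_gt r0 hxy.
  have [k [k0 rk ek]] := agreement_gt r0 hyz.
  have m0 : (0 < minn h k)%N by rewrite leq_min h0.
  have : restr (minn h k) x = restr (minn h k) z.
    rewrite -(restr_restr x (geq_minl h k)) eh restr_restr ?geq_minl//.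
    by rewrite -(restr_restr y (geq_minr h k)) ek restr_restr ?geq_minr.
  move=> /(agreement_ge m0); rewrite E lee_fin leNgt => /negP[].
  by rewrite /minn; case: ifP.
- by rewrite (le_trans (exp2N_le (agreement_ge0 _ _) h))// lerDl exp2N_ge0.
- by rewrite (le_trans (exp2N_le (agreement_ge0 _ _) h))// lerDr exp2N_ge0.
Qed.

End local_distance.

(* The parameter R, the field in which the distance takes its values, only
   serves the inference of the metric structure. *)
Definition rooted_space (R : realType) : Type := rooted_perm.

HB.instance Definition _ (R : realType) := Pointed.on (rooted_space R).
HB.instance Definition _ (R : realType) := @isMetric.Build R (rooted_space R)
  (@local_dist R) (@local_distxx R) (@local_dist_positivity R)
  (@local_dist_sym R) (@local_dist_triangle R).

Definition borel (T : ptopologicalType) := g_sigma_algebraType (@open T).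

Record bounded_continuous (R : realType) (T : topologicalType) := BoundedCont {
  bc_fun :> T -> R ;
  bc_continuous : continuous bc_fun ;
  bc_bounded : exists M : R, forall x, `|bc_fun x| <= M }.

HB.instance Definition _ (R : realType) (T : topologicalType) :=
  gen_eqMixin (bounded_continuous R T).
HB.instance Definition _ (R : realType) (T : topologicalType) :=
  gen_choiceMixin (bounded_continuous R T).

Definition weak_prob (R : realType) (T : ptopologicalType) : Type :=
  probability (borel T) R.

Definition weak_eval (R : realType) (T : ptopologicalType)
    (mu : weak_prob R T) : {ptws bounded_continuous R T -> R} :=
  fun f => (\int[mu]_(x in [set: borel T]) f x)%R.

HB.instance Definition _ (R : realType) (T : ptopologicalType) :=
  Pointed.copy (weak_prob R T) (probability (borel T) R).
HB.instance Definition _ (R : realType) (T : ptopologicalType) :=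
  Topological.copy (weak_prob R T) (initial_topology (@weak_eval R T)).

Definition cvg_in_distribution (R : realType) (E : ptopologicalType)
    (d : nat -> measure_display) (Omega : forall n, measurableType (d n))
    (P : forall n, probability (Omega n) R)
    (X : forall n, {RV P n >-> borel E})
    (d' : measure_display) (Omega' : measurableType d')
    (P' : probability Omega' R) (X' : {RV P' >-> borel E}) : Prop :=
  forall F : bounded_continuous R E,
    'E_(P n)[F \o X n]%E @[n --> \oo] --> 'E_P'[F \o X']%E.

Arguments cvg_in_distribution {R E d Omega} P X {d' Omega'} P' X'.

Section root_law.
Variables (R : realType) (sigma : perms).

(* The law of (sigma, i) with i uniform among the positions of sigma. *)
Definition root_law (B : set (borel (rooted_space R))) : \bar R :=
  (((tag sigma).+1%:R^-1)%:E *
    \sum_(i < (tag sigma).+1)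
      \d_(finite_rooted (tagged sigma) i : borel (rooted_space R)) B)%E.

Let nu : {measure set (borel (rooted_space R)) -> \bar R} :=
  mscale ((tag sigma).+1%:R^-1 : R)%:nng
    (msum (fun k => \d_(finite_rooted (tagged sigma) (inord k) :
       borel (rooted_space R))) (tag sigma).+1).

Let root_lawE : root_law = nu :> (set _ -> \bar R).
Proof.
apply/funext => B; rewrite /root_law /nu /mscale /= /msum; congr (_ * _)%E.
by apply: eq_bigr => i _; rewrite inord_val.
Qed.

Let root_law0 : root_law set0 = 0%E.
Proof. by rewrite root_lawE measure0. Qed.

Let root_law_ge0 B : (0 <= root_law B)%E.
Proof. by rewrite root_lawE measure_ge0. Qed.

Let root_law_sigma_additive : semi_sigma_additive root_law.
Proof. by rewrite root_lawE; exact: measure_semi_sigma_additive. Qed.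

HB.instance Definition _ := isMeasure.Build _ _ _ root_law
  root_law0 root_law_ge0 root_law_sigma_additive.

Let root_law_setT : root_law [set: _] = 1%E.
Proof.
rewrite /root_law; under eq_bigr do rewrite diracT.
by rewrite sumEFin sumr_const card_ord -EFinM mulVf// pnatr_eq0.
Qed.

HB.instance Definition _ :=
  Measure_isProbability.Build _ _ _ root_law root_law_setT.

End root_law.

Definition quenched_law (R : realType) (sigma : perms) :
  borel (weak_prob R (rooted_space R)) := root_law sigma : probability _ R.

Lemma measurable_quenched_law (R : realType) :
  measurable_fun [set: perms] (@quenched_law R).
Proof. by []. Qed.

HB.instance Definition _ (R : realType) :=
  isMeasurableFun.Build _ _ _ _ (@quenched_law R) (@measurable_quenched_law R).

Definition quenched_BS_cvg (R : realType)
    (d : nat -> measure_display) (Omega : forall n, measurableType (d n))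
    (P : forall n, probability (Omega n) R)
    (sigma : forall n, {RV P n >-> perms})
    (d' : measure_display) (Omega' : measurableType d')
    (P' : probability Omega' R)
    (mu : {RV P' >-> borel (weak_prob R (rooted_space R))}) : Prop :=
  cvg_in_distribution P (fun n => @quenched_law R \o sigma n) P' mu.

Arguments quenched_BS_cvg {R d Omega} P sigma {d' Omega'} P' mu.

(* Main.v *)
(** A 321-avoiding permutation [s] of size N is determined by two binary words
    of length N: which positions, and which values, are those of left-to-right
    maxima (records). There are at least 4^N / ((2N + 1)(N + 1)) such
    permutations, so any event of probability O(exp (- c N)) for a pair of
    independent uniform words is negligible for a uniform 321-avoiding
    permutation. Two events of this kind are enough. First, the empirical
    distribution of the windows of fixed length of the word of positions is
    exponentially close to uniform. Second, let the overhang at m be the number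
    of records before m with value at least m; it is the height of the lattice
    path coded by the two words, and this path spends a proportion of time
    bounded below at a given height with exponentially small probability only.
    When the overhang at m is larger than h + 1, all the records in the window
    [m - h, m + h] lie above m and all the other entries below, so the window is
    a merge of two increasing sequences prescribed by the word of positions. The
    limit is thus the merge of two increasing sequences, one lying above the
    other, driven by fair coins indexed by the integers; the coins are taken to
    be binary digits of a uniform point of [0, 1). *)
From HB Require Import structures.
Require Import Defs.
From mathcomp Require Import all_boot all_order all_algebra all_fingroup.
From mathcomp Require Import all_classical all_reals all_analysis.
From mathcomp Require Import measurable_realfun zify ring lra.

Set Implicit Arguments.
Unset Strict Implicit.
Unset Printing Implicit Defensive.
Import Order.TTheory GRing.Theory Num.Theory.
Import numFieldNormedType.Exports.
Local Open Scope classical_set_scope.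
Local Open Scope ring_scope.

(** * Counting 321-avoiding permutations *)

Lemma Av321P n (s : 'S_n) :
  reflect (forall i j k : 'I_n, (i < j)%N -> (j < k)%N ->
             (s j < s i)%N -> (s k < s j)%N -> False)
          (s \in Av321 n).
Proof.
rewrite inE; apply: (iffP idP) => [/existsPn H i j k ij jk ji kj | H].
  move: (H i) => /existsPn/(_ j)/existsPn/(_ k).
  by rewrite ij jk ji kj.
apply/existsPn => i; apply/existsPn => j; apply/existsPn => k.
by apply/negP => /and4P[ij jk ji kj]; exact: (H i j k).
Qed.

Definition sorted_suffix n L (s : 'S_n) :=
  [forall i : 'I_n, forall j : 'I_n,
    (n <= i + L)%N && (i < j)%N ==> (s i < s j)%N].

Lemma sorted_suffixP n L (s : 'S_n) :
  reflect (forall i j : 'I_n, (n <= i + L)%N -> (i < j)%N -> (s i < s j)%N)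
          (sorted_suffix L s).
Proof.
apply: (iffP forallP) => [H i j iL ij | H i].
  by move: (H i) => /forallP/(_ j)/implyP; apply; rewrite iL.
by apply/forallP => j; apply/implyP => /andP[]; exact: H.
Qed.

Definition Av321_suffix n L := [set s in Av321 n | sorted_suffix L s].

(** The inserted maximum can only be the first entry of a decreasing triple, so it is enough that
    the [n - p] entries to its right increase. *)
Lemma lift_perm_max_Av321 n (s : 'S_n) (p : 'I_n.+1) :
  s \in Av321 n -> sorted_suffix (n - p) s ->
  lift_perm p ord_max s \in Av321 n.+1.
Proof.
move=> /Av321P sA /sorted_suffixP sL; apply/Av321P => i j k ij jk.
set t := lift_perm p ord_max s.
have tmax (x : 'I_n.+1) : (n < t x)%N = false by rewrite ltnNge -ltnS ltn_ord.
have tp : t p = ord_max by rewrite /t lift_perm_id.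
have tl x : t (lift p x) = s x :> nat.
  by rewrite /t lift_perm_lift lift_max.
case: (unliftP p j) ij jk => [j' ->|-> _ _]; last first.
  by rewrite tp /= tmax.
case: (unliftP p k) => [k' ->|-> _ _ _]; last first.
  by rewrite tp /= tmax.
case: (unliftP p i) => [i' ->|->].
  rewrite !tl => ij jk; apply: sA; move: ij jk.
  - by rewrite /lift /= /bump; lia.
  - by rewrite /lift /= /bump; lia.
rewrite !tl => pj jk _; apply/negP; rewrite -leqNgt ltnW//; apply: sL.
  by move: pj; have := ltn_ord p; rewrite /lift /= /bump; lia.
by move: jk; rewrite /lift /= /bump; lia.
Qed.

Lemma lift_perm_max_suffix n (s : 'S_n) (p : 'I_n.+1) L :
  sorted_suffix L s -> (p + L == n)%N || (p == ord_max) ->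
  sorted_suffix (if p == ord_max then L.+1 else L) (lift_perm p ord_max s).
Proof.
move=> /sorted_suffixP sL pL; apply/sorted_suffixP => i j.
set t := lift_perm p ord_max s.
have tp : t p = ord_max by rewrite /t lift_perm_id.
have tl x : t (lift p x) = s x :> nat.
  by rewrite /t lift_perm_lift lift_max.
case: (unliftP p j) => [j' ->|->]; last first.
  move=> iL ip; rewrite tp; case: (unliftP p i) ip => [i' ->|->]; last by rewrite ltnn.
  by rewrite tl /=.
case: (unliftP p i) => [i' ->|->].
  rewrite !tl => iL ij; apply: sL; move: iL ij pL.
  - by rewrite -(inj_eq val_inj) /lift /= /bump; have := ltn_ord i'; case: ifP; lia.
  - by rewrite /lift /= /bump; lia.
case: eqP => [-> _|]; first by rewrite lift_max /= ltnNge ltnW.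
by move=> /eqP/negPf pm; rewrite pm orbF in pL; lia.
Qed.

(* A maximum is inserted before the last L + 1 entries when these are increasing,
   and at the end otherwise. *)
Lemma Av321_suffix_rec n L : (L < n)%N ->
  (#|Av321_suffix n.+1 L.+2| + #|Av321_suffix n L| <=
   #|Av321_suffix n.+1 L.+1|)%N.
Proof.
move=> Ln.
pose pos (s : 'S_n) : 'I_n.+1 :=
  if sorted_suffix L.+1 s then inord (n - L.+1) else ord_max.
have posE (s : 'S_n) : sorted_suffix L.+1 s -> pos s = (n - L.+1)%N :> nat.
  by rewrite /pos => ->; rewrite inordK; lia.
have posN (s : 'S_n) : ~~ sorted_suffix L.+1 s -> pos s = ord_max.
  by rewrite /pos => /negPf ->.
pose ins (s : 'S_n) := lift_perm (pos s) ord_max s.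
have ins_inj : injective ins.
  move=> s t st; have pst : pos s = pos t.
    by apply: (@perm_inj _ (ins s)); rewrite {2}st /ins !lift_perm_id.
  apply/permP => x; apply: val_inj => /=.
  have := congr1 (fun f : 'S_n.+1 => nat_of_ord (f (lift (pos s) x))) st.
  by rewrite /ins lift_perm_lift pst lift_perm_lift !lift_max => ->.
rewrite -(card_imset _ ins_inj) -cardsUI.
(* No image has its last L + 2 entries increasing: either the new maximum is followed by L + 1
   entries, or it comes last, after L + 1 entries that are not increasing. *)
have -> : Av321_suffix n.+1 L.+2 :&: ins @: Av321_suffix n L = finset.set0.
  apply/setP => t; rewrite inE finset.in_set0; apply/negP => /andP[].
  rewrite inE => /andP[_ /sorted_suffixP tL] /imsetP[s].
  rewrite inE => /andP[sA sL] ts; subst t.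
  case: (boolP (sorted_suffix L.+1 s)) => [/posE pE|sL1].
    have := tL (pos s) ord_max; rewrite lift_perm_id pE /= => H.
    have : (n < ins s ord_max)%N by apply: H; lia.
    by have := ltn_ord (ins s ord_max); lia.
  move/posN: (sL1) => pE.
  move/negP: sL1; apply; apply/sorted_suffixP => i j iL ij.
  have := tL (lift ord_max i) (lift ord_max j).
  by rewrite /ins pE !lift_perm_lift !lift_max; apply => //; lia.
rewrite cards0 addn0; apply: subset_leq_card; apply/fintype.subsetP => t.
rewrite finset.in_setU => /orP[|].
  rewrite !inE => /andP[-> /sorted_suffixP tL] /=.
  by apply/sorted_suffixP => i j iL; apply: tL; lia.
move=> /imsetP[s]; rewrite inE => /andP[sA sL] ->; rewrite inE /ins.
case: (boolP (sorted_suffix L.+1 s)) => [sL1|/posN pE].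
  have pE := posE _ sL1; apply/andP; split.
    apply: lift_perm_max_Av321 => //; rewrite pE.
    by have -> : (n - (n - L.+1) = L.+1)%N by lia.
  have pm : (pos s == ord_max) = false.
    by apply/eqP => /(congr1 (@nat_of_ord _)); rewrite pE /=; lia.
  have := @lift_perm_max_suffix _ s (pos s) L.+1 sL1.
  by rewrite pm orbF pE; apply; apply/eqP; lia.
rewrite pE; apply/andP; split.
  apply: lift_perm_max_Av321 => //; rewrite /= subnn.
  by apply/sorted_suffixP => i j; have := ltn_ord i; lia.
by have := @lift_perm_max_suffix _ s ord_max L sL; rewrite eqxx orbT; apply.
Qed.

Lemma Av321_suffix_all n : (0 < #|Av321_suffix n n|)%N.
Proof.
apply/card_gt0P; exists 1%g; rewrite inE; apply/andP; split.
  by apply/Av321P => i j k; rewrite !perm1; lia.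
by apply/sorted_suffixP => i j; rewrite !perm1.
Qed.

Lemma Av321_suffix01 n : Av321_suffix n 1 = Av321_suffix n 0.
Proof.
apply/setP => s; rewrite !inE; congr (_ && _).
apply/sorted_suffixP/sorted_suffixP => sL i j iL ij.
  by have := ltn_ord i; lia.
by have := ltn_ord j; lia.
Qed.

(** The difference of the two binomials is a ballot number, and ballot numbers satisfy the
    recurrence of [Av321_suffix_rec] with equality. The induction is on [n], then downwards on [L];
    the case [L = 0] reduces to [L = 1] by the symmetry of the binomials. *)
Lemma ballot_le_Av321_suffix n L : (L <= n)%N ->
  ('C(n.*2 - L, n) <= #|Av321_suffix n L| + 'C(n.*2 - L, n.+1))%N.
Proof.
elim: n L => [|n IHn] L.
  by rewrite leqn0 => /eqP ->; have := Av321_suffix_all 0; rewrite bin0; lia.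
have [m] : exists m, (n.+1 - L = m)%N by exists (n.+1 - L)%N.
elim: m L => [|m IHm] L mL Ln.
  have -> : L = n.+1 by lia.
  rewrite -addnn addnK binn.
  by have := Av321_suffix_all n.+1; lia.
case: L mL Ln => [|L] mL Ln.
  have := IHm 1; rewrite Av321_suffix01 => /(_ _ _)H.
  have {}H := H ltac:(lia) isT; move: H; rewrite doubleS subn0 subn1 /=.
  rewrite (binS n.*2.+1 n.+1) (binS n.*2.+1 n).
  have -> : 'C(n.*2.+1, n) = 'C(n.*2.+1, n.+1).
    by rewrite -(@bin_sub n.*2.+1 n.+1); [congr ('C(_, _)); lia|lia].
  by lia.
have := Av321_suffix_rec (L := L) (n := n) ltac:(lia).
have := IHm L.+2 ltac:(lia) ltac:(lia).
have := IHn L ltac:(lia).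
have -> : (n.+1.*2 - L.+1 = (n.*2 - L).+1)%N by lia.
have -> : (n.+1.*2 - L.+2 = n.*2 - L)%N by lia.
by rewrite !binS; lia.
Qed.

Lemma expn4_le_central_bin n : (4 ^ n <= n.*2.+1 * 'C(n.*2, n))%N.
Proof.
elim: n => [|n IHn]; first by rewrite bin0.
have H1 := mul_bin_diag n.*2.+2 n.
have H2 := mul_bin_diag n.*2.+1 n.
have H3 : 'C(n.*2.+1, n) = 'C(n.*2.+1, n.+1).
  by rewrite -(@bin_sub n.*2.+1 n.+1); [congr ('C(_, _)); lia|lia].
rewrite doubleS expnS; move: H1 H2 IHn; rewrite /= H3.
set a := 'C(n.*2.+2, n.+1); set b := 'C(n.*2.+1, n.+1); set c := 'C(n.*2, n).
rewrite -!addnn; nia.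
Qed.

Lemma expn4_le_Av321 n : (4 ^ n <= n.*2.+1 * n.+1 * #|Av321 n|)%N.
Proof.
(* At [L = 0] the ballot number is the Catalan number C(2n, n) / (n + 1). *)
have le1 : ('C(n.*2, n) <= n.+1 * #|Av321 n|)%N.
  have := ballot_le_Av321_suffix (leq0n n); rewrite subn0.
  have : (#|Av321_suffix n 0| <= #|Av321 n|)%N.
    by apply: subset_leq_card; apply/fintype.subsetP => s; rewrite inE => /andP[].
  have := mul_bin_left n.*2 n.
  have -> : (n.*2 - n = n)%N by lia.
  nia.
by apply: leq_trans (expn4_le_central_bin n) _; rewrite -mulnA leq_mul2l le1 orbT.
Qed.

(** * Records and the local structure of 321-avoiding permutations *)

Definition is_record n (s : 'S_n) (i : 'I_n) :=
  [forall j : 'I_n, (j < i)%N ==> (s j < s i)%N].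

Lemma is_recordP n (s : 'S_n) (i : 'I_n) :
  reflect (forall j : 'I_n, (j < i)%N -> (s j < s i)%N) (is_record s i).
Proof.
by apply: (iffP forallP) => H j; [apply/implyP|apply/implyP; exact: H].
Qed.

Lemma perm_val_eq n (s : 'S_n) (i j : 'I_n) :
  (s i == s j :> nat) = (i == j :> nat).
Proof. by rewrite !(inj_eq val_inj) (inj_eq perm_inj). Qed.

(** A record exceeds all that precedes it. An inversion between two non-records would form a 321
    pattern with a larger entry preceding the first of them. *)
Lemma Av321_lt_same_record n (s : 'S_n) (i j : 'I_n) : s \in Av321 n ->
  is_record s i = is_record s j -> (i < j)%N -> (s i < s j)%N.
Proof.
move=> /Av321P sA; case: (boolP (is_record s j)) => [/is_recordP H _|_ iN ij].
  exact: H.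
rewrite ltnNge; apply/negP => ji.
have {}ji : (s j < s i)%N by have := perm_val_eq s i j; lia.
move/negbT: iN => /forallPn[k]; rewrite negb_imply -leqNgt => /andP[ki ik].
apply: (sA k i j ki ij) => //.
by have := perm_val_eq s i k; lia.
Qed.

Lemma Av321_ltE n (s : 'S_n) (i j : 'I_n) : s \in Av321 n ->
  is_record s i = is_record s j -> (s i < s j)%N = (i < j)%N.
Proof.
move=> sA ij; have H1 := Av321_lt_same_record sA ij.
have H2 := Av321_lt_same_record sA (esym ij).
by have := perm_val_eq s i j; case: (ltngtP i j) H1 H2 => //; lia.
Qed.

Lemma sum_ord_ltn n m : (m <= n)%N -> (\sum_(q < n) (q < m)%N = m)%N.
Proof.
move=> mn; rewrite -(big_mkord xpredT (fun q => (q < m : nat)%N)).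
rewrite (@big_cat_nat _ _ _ m 0 n)//= [X in (X + _)%N]big_nat.
rewrite (eq_bigr (fun=> 1%N)); last by move=> i /andP[_ ->].
rewrite -big_nat sum_nat_const_nat subn0 muln1 big_nat big1 ?addn0// => i /andP[mi _].
by rewrite ltnNge mi.
Qed.

Lemma sum_ord_itv n a b : (\sum_(q < n) ((a <= q) && (q < b))%N <= b - a)%N.
Proof.
suff : (\sum_(q < n) ((a <= q) && (q < b))%N <= minn n b - a)%N by lia.
elim: n => [|n IHn]; first by rewrite big_ord0.
rewrite big_ord_recr /=; move: IHn; set S := (\sum_(_ < _) _)%N.
by case: (leqP a n); case: (ltnP n b) => //=; lia.
Qed.

Lemma sum_perm_ltn n (s : 'S_n) m :
  (\sum_(q < n) (s q < m) = \sum_(q < n) (q < m))%N.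
Proof. by rewrite [RHS](reindex_inj (@perm_inj _ s)). Qed.

(** The [i] earlier entries take distinct values below [s i]. *)
Lemma is_record_le n (s : 'S_n) (i : 'I_n) : is_record s i -> (i <= s i)%N.
Proof.
move=> /is_recordP H; rewrite -(sum_ord_ltn (ltnW (ltn_ord i))).
rewrite -(sum_ord_ltn (ltnW (ltn_ord (s i)))) -(sum_perm_ltn s (s i)).
by apply: leq_sum => j _; case: (ltnP j i) => // ji; rewrite (H _ ji).
Qed.

Definition record_word n (s : 'S_n) : n.-tuple (bool * bool) :=
  [tuple (is_record s i, is_record s ((s^-1)%g i)) | i < n].

(** Since [s] is increasing on the records and on the non-records, an entry has the same rank in its
    class by position and by value. *)
Lemma Av321_rank n (s : 'S_n) (i : 'I_n) : s \in Av321 n ->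
  (\sum_(q < n) ((q < i) && (is_record s q == is_record s i)) =
   \sum_(q < n) ((q < s i) && (is_record s ((s^-1)%g q) == is_record s i)))%N.
Proof.
move=> sA; rewrite [RHS](reindex_inj (@perm_inj _ s)).
apply: eq_bigr => q _; rewrite permK.
by case: eqP => [e|]; rewrite ?andbF// !andbT (Av321_ltE sA e).
Qed.

Lemma record_word_inj n : {in Av321 n &, injective (@record_word n)}.
Proof.
move=> s t sA tA est.
have U i : is_record s i = is_record t i.
  by have := congr1 (fun w => tnth w i) est; rewrite !tnth_mktuple => -[].
have V i : is_record s ((s^-1)%g i) = is_record t ((t^-1)%g i).
  by have := congr1 (fun w => tnth w i) est; rewrite !tnth_mktuple => -[].
have nlt (r r' : 'S_n) i : r \in Av321 n -> r' \in Av321 n ->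
    (forall i, is_record r i = is_record r' i) ->
    (forall i, is_record r ((r^-1)%g i) = is_record r' ((r'^-1)%g i)) ->
    ~ (r i < r' i)%N.
  move=> rA r'A rU rV lt; have := Av321_rank i rA; have := Av321_rank i r'A.
  under eq_bigr do rewrite -!rU; move=> ->.
  under eq_bigr do rewrite -rV -rU; move=> /esym.
  (* The value [r i] belongs to the class of [i] and lies below [r' i]: it is counted in the rank
     for [r'] but not in the rank for [r], whereas the two ranks are equal. *)
  rewrite (bigD1 (r i)) //= [RHS](bigD1 (r i)) //= lt ltnn permK eqxx /=.
  set S := (\sum_(_ < _ | _) _)%N; set S' := (\sum_(_ < _ | _) _)%N => SE.
  have : (S <= S')%N; last by move: SE; lia.
  apply: leq_sum => q _; case: (ltnP q (r i)) => //= qi.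
  by rewrite (ltn_trans qi lt).
apply/permP => i; apply/ord_inj/eqP; rewrite eqn_leq leqNgt (leqNgt (t i)).
apply/andP; split; apply/negP.
  exact: (nlt t s i tA sA (fsym U) (fsym V)).
exact: (nlt s t i sA tA U V).
Qed.

(** * Separation of records and non-records where the overhang is large *)

Section separation.
Variables (n : nat) (s : 'S_n) (m : nat).
(* The height after m steps of the path coded by [record_word s]. *)
Definition overhang := (\sum_(q < n) [&& q < m, m <= s q & is_record s q])%N.

(** A record [q] with [s q < m] also has [q < m] by [is_record_le], so it cancels between the counts
    by position and by value. The overhang is thus a walk whose increments are the letters of
    [record_word]. *)
Lemma overhangE : overhang%:Z = \sum_(q < n)
  (((q < m)%N && is_record s q)%:Z - ((q < m)%N && is_record s ((s^-1)%g q))%:Z).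
Proof.
rewrite big_split /= sumrN.
rewrite [X in _ - X](reindex_inj (@perm_inj _ s)) /= -sumrN -big_split /=.
rewrite /overhang (big_morph Posz PoszD (erefl 0%:Z)).
apply: eq_bigr => q _; rewrite permK.
have := @is_record_le _ s q.
by case: is_record => [/(_ isT)|]; case: ltnP; case: ltnP => //=; lia.
Qed.

Hypothesis sA : s \in Av321 n.
Variable h : nat.
Hypothesis hm : (h.+1 < overhang)%N.

(** If [s p < m], the records counted by the overhang exceed [s p], hence do not precede [p]. They
    all lie in [[m - h, m)], which leaves room for at most [h] of them. *)
Lemma record_above (p : 'I_n) :
  (m <= p + h)%N -> is_record s p -> (m <= s p)%N.
Proof.
move=> mp rp; rewrite leqNgt; apply/negP => pm.
have : (overhang <= \sum_(q < n) ((m - h <= q) && (q < m)))%N.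
  apply: leq_sum => q _; case: ltnP => //= qm.
  case: (leqP m (s q)) => //= mq; case: (boolP (is_record s q)) => //= rq.
  rewrite andbT lt0b; apply/negPn; rewrite -ltnNge; apply/negP => qmh.
  move/is_recordP: rp => /(_ q); have : (q < p)%N by lia.
  by move=> qp /(_ qp); lia.
have := sum_ord_itv n (m - h) m; lia.
Qed.

(** As many entries leave [[0, m)] as enter it, so the overhang is at most the number of entries
    from [m] on with value below [m], all non-records. If [m <= s p], these all precede [p], as
    non-records increase, and so lie in [[m, m + h]]. *)
Lemma nonrecord_below (p : 'I_n) :
  (p <= m + h)%N -> ~~ is_record s p -> (s p < m)%N.
Proof.
move=> pm rp; rewrite ltnNge; apply/negP => mp.
have : (overhang <= \sum_(q < n) ((m <= q) && (q < m + h.+1)))%N.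
  rewrite -(leq_add2r (\sum_(q < n) (s q < m))%N) {2}sum_perm_ltn /overhang.
  rewrite -!big_split /=.
  apply: leq_sum => q _.
  have := @is_record_le _ s q; case: (boolP (is_record s q)) => [_ /(_ isT)|rq _].
    by case: ltnP; case: ltnP; case: ltnP => //=; lia.
  rewrite !andbF add0n.
  case: (ltnP (s q) m) => // qm; case: (ltnP q m) => // mq; rewrite addn0 /= lt0b.
  rewrite ltnNge; apply/negP => qmh.
  have pq : (p < q)%N by lia.
  have := Av321_lt_same_record sA _ pq; rewrite (negPf rp) (negPf rq) => /(_ erefl).
  by lia.
have := sum_ord_itv n m (m + h.+1); lia.
Qed.

Lemma Av321_window_le (p q : 'I_n) :
  (m <= p + h)%N -> (p <= m + h)%N -> (m <= q + h)%N -> (q <= m + h)%N ->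
  (s p <= s q)%N = (is_record s p < is_record s q)%N ||
    ((is_record s p == is_record s q) && (p <= q)%N).
Proof.
move=> mp pm mq qm.
have := @record_above p mp; have := @nonrecord_below p pm.
have := @record_above q mq; have := @nonrecord_below q qm.
have := @Av321_ltE _ s q p sA.
case: is_record; case: is_record => /=.
- by move=> /(_ erefl) ? _ _ _ _; lia.
- by move=> _ _ /(_ isT) ? /(_ isT) ? _; lia.
- by move=> _ /(_ isT) ? _ _ /(_ isT) ?; lia.
- by move=> /(_ erefl) ? _ _ _ _; lia.
Qed.

End separation.

(** * Merges of two increasing sequences, one above the other *)

Section merge.
Variable b : int -> bool.

Let le (x y : int) := (b x < b y)%N || ((b x == b y) && (x <= y)).

Let le_refl x : [set: int] x -> le x x.
Proof. by rewrite /le eqxx lexx orbT. Qed.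

Let le_anti x y : le x y -> le y x -> x = y.
Proof. by rewrite /le; case: (b x); case: (b y) => //= *; lia. Qed.

Let le_trans y x z : le x y -> le y z -> le x z.
Proof. by rewrite /le; case: (b x); case: (b y); case: (b z) => //= *; lia. Qed.

Let le_total x y : [set: int] x -> [set: int] y -> le x y \/ le y x.
Proof. by rewrite /le => _ _; apply/orP; case: (b x); case: (b y) => //=; lia. Qed.

(** The bit [true] plays the part of the records, which form the upper sequence. *)
Definition merge_perm : rooted_perm :=
  @RootedPerm [set: int] le I (fun _ _ _ _ _ _ => I) (fun _ _ _ => conj I I)
    le_refl le_anti le_trans le_total.

End merge.

Lemma merge_perm_infinite b : infinite_rooted (merge_perm b).
Proof.
move=> fin; apply: infinite_nat.
by apply: (@finite_preimage _ _ [set: int] Posz) => // m n _ _ [].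
Qed.

Lemma restr_merge_perm h (b b' : int -> bool) :
  (forall l : int, - h%:Z <= l <= h%:Z -> b l = b' l) ->
  restr h (merge_perm b) = restr h (merge_perm b').
Proof.
move=> bb; apply: rooted_permP => //=; apply/funext => l; apply/funext => j.
rewrite propeqE; split => -[[? /= lh] [? /= jh]] H; split => //.
  by rewrite -!bb.
by rewrite !bb.
Qed.

Lemma restr_finite_rooted n (s : 'S_n.+1) (i : 'I_n.+1) h (b : int -> bool) :
  s \in Av321 n.+1 -> (h <= i)%N -> (i + h <= n)%N -> (h.+1 < overhang s i)%N ->
  (forall p : 'I_n.+1, (i <= p + h)%N -> (p <= i + h)%N ->
     b (p%:Z - i%:Z) = is_record s p) ->
  restr h (finite_rooted s i) = restr h (merge_perm b).
Proof.
move=> sA hi hin ov bs.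
have dE : rdom (restr h (finite_rooted s i)) = rdom (restr h (merge_perm b)).
  by apply/seteqP; split => l /= -[? ?]; split => //; lia.
apply: rooted_permP => //; apply/funext => l; apply/funext => j.
rewrite propeqE; split => /= -[[l1 l2] [j1 j2]].
  move=> [p [q [pE qE]]]; rewrite (Av321_window_le sA ov); [|lia..].
  have -> : l = p%:Z - i%:Z by lia.
  have -> : j = q%:Z - i%:Z by lia.
  move=> H; split; [by split=> //=; lia|by split=> //=; lia|].
  rewrite !bs; [|lia..].
  by case/orP: H => [->//|/andP[-> ?]]; apply/orP; right => /=; lia.
have lP : (`|(l + i%:Z)%R| < n.+1)%N by lia.
have jP : (`|(j + i%:Z)%R| < n.+1)%N by lia.
pose p := Ordinal lP; pose q := Ordinal jP.
have pE : p%:Z = l + i%:Z by rewrite /=; lia.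
have qE : q%:Z = j + i%:Z by rewrite /=; lia.
have bl : b l = is_record s p by rewrite -bs; [congr b; lia|lia..].
have bj : b j = is_record s q by rewrite -bs; [congr b; lia|lia..].
move=> H; split; [by split=> //=; lia|by split=> //=; lia|].
exists p, q; split => //; rewrite (Av321_window_le sA ov); [|lia..].
move: H; rewrite bl bj.
by case/orP => [->//|/andP[-> ?]]; apply/orP; right => /=; lia.
Qed.

(** * Large deviations for uniform words *)

Section words.
Variables (R : realType) (T : finType).
Implicit Type F : seq T -> R.

Lemma sum_tuple0 F : \sum_(t : 0.-tuple T) F t = F [::].
Proof.
rewrite (big_pred1 [tuple]) // => t.
by apply/esym/eqP; exact: tuple0.
Qed.

Lemma sum_tupleS n F :
  \sum_(t : n.+1.-tuple T) F t = \sum_a \sum_(t : n.-tuple T) F (a :: t).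
Proof.
rewrite pair_big /= (reindex (fun p : T * n.-tuple T => [tuple of p.1 :: p.2])) //=.
exists (fun t => (thead t, [tuple of behead t])) => [[a t] _|t _] /=.
  by rewrite theadE; congr pair; apply: val_inj.
by rewrite [RHS]tuple_eta.
Qed.

Lemma sum_tuple_cat m n F : \sum_(t : (m + n).-tuple T) F t =
  \sum_(x : m.-tuple T) \sum_(y : n.-tuple T) F (x ++ y).
Proof.
elim: m F => [|m IHm] F.
  by rewrite (sum_tuple0 (fun x => \sum_(y : n.-tuple T) F (x ++ y))).
rewrite addSn sum_tupleS (sum_tupleS _ (fun x => \sum_(y : n.-tuple T) F (x ++ y))).
by apply: eq_bigr => a _; rewrite (IHm (fun t => F (a :: t))).
Qed.

Lemma sum_tuple_drop r n F : \sum_(t : (r + n).-tuple T) F (drop r t) =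
  #|T|%:R ^+ r * \sum_(t : n.-tuple T) F t.
Proof.
rewrite (sum_tuple_cat _ _ (fun t => F (drop r t))).
under eq_bigr => x _ do under eq_bigr => y _ do rewrite drop_size_cat ?size_tuple//.
by rewrite sumr_const card_tuple -natrX mulr_natl.
Qed.

(** The [q] disjoint blocks of a uniform word are independent, so the exponential moment factorizes;
    the last [s] letters are free. *)
Lemma sum_expR_blocks m q s F :
  \sum_(t : (q * m + s).-tuple T)
     expR (\sum_(j < q) F (take m (drop (j * m) t))) =
  (\sum_(w : m.-tuple T) expR (F w)) ^+ q * #|T|%:R ^+ s.
Proof.
elim: q => [|q IHq].
  under eq_bigr do rewrite big_ord0 expR0.
  by rewrite sumr_const card_tuple natrX expr0 mul1r.
rewrite mulSn -addnA.
rewrite (sum_tuple_cat _ _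
  (fun t => expR (\sum_(j < q.+1) F (take m (drop (j * m) t))))) exprS -mulrA -IHq.
rewrite mulr_suml; apply: eq_bigr => x _; rewrite mulr_sumr; apply: eq_bigr => y _.
rewrite big_ord_recl expRD mul0n drop0 take_size_cat ?size_tuple//; congr (_ * expR _).
apply: eq_bigr => j _; rewrite /= /bump add1n mulSn addnC -drop_drop.
by rewrite drop_size_cat ?size_tuple.
Qed.

End words.

Section deviations.
Variable R : realType.

Lemma expR_le_inv (x : R) : x < 1 -> expR x <= (1 - x)^-1.
Proof.
move=> x1; rewrite -[x in expR x]opprK expRN lef_pV2 ?posrE ?expR_gt0 ?subr_gt0//.
by have := expR_ge1Dx (- x).
Qed.

Lemma expR_le_quadratic (x : R) : `|x| <= 2^-1 -> expR x <= 1 + x + 2 * x ^+ 2.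
Proof.
rewrite ler_norml => /andP[x1 x2]; apply: le_trans (expR_le_inv _) _; first by lra.
rewrite -div1r ler_pdivrMr; last by lra.
(* This is the excess over 1 of the product of [1 + x + 2 * x ^+ 2] and [1 - x]. *)
suff : 0 <= x ^+ 2 * (1 - 2 * x) by lra.
by rewrite mulr_ge0 ?sqr_ge0//; lra.
Qed.

Lemma card_markov (X : finType) (g : X -> R) (c : R) :
  #|[pred x | c <= g x]|%:R * expR c <= \sum_x expR (g x).
Proof.
rewrite mulr_natl -sumr_const [leRHS](bigID [pred x | c <= g x]) /=.
rewrite -[leLHS]addr0 lerD ?sumr_ge0//.
by apply: ler_sum => x; rewrite inE ler_expR.
Qed.

(** Windows of length [m] starting in the same residue class modulo [m] are disjoint, which restores
    independence among overlapping windows. *)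
Lemma sum_residues m q (a : nat -> R) :
  \sum_(i < q * m) a i = \sum_(r < m) \sum_(j < q) a (r + j * m)%N.
Proof.
rewrite exchange_big /=; elim: q => [|q IHq]; first by rewrite !big_ord0.
rewrite mulSnr big_split_ord /= big_ord_recr /= IHq; congr (_ + _).
by apply: eq_bigr => i _; rewrite addnC.
Qed.

Lemma sum_expR_le (T : finType) m (F : seq T -> R) (M l : R) :
  (forall w, `|F w| <= M) -> \sum_(w : m.-tuple T) F w = 0 -> 0 <= l -> l * M <= 2^-1 ->
  \sum_(w : m.-tuple T) expR (l * F w) <= #|T|%:R ^+ m * expR (2 * (l * M) ^+ 2).
Proof.
move=> FM F0 l0 lM; apply: (@le_trans _ _
  (\sum_(w : m.-tuple T) (1 + l * F w + 2 * (l * M) ^+ 2))).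
  apply: ler_sum => w _; have lF : `|l * F w| <= l * M.
    by rewrite normrM ger0_norm// ler_wpM2l.
  apply: le_trans (expR_le_quadratic (le_trans lF lM)) _.
  rewrite lerD2l ler_wpM2l// -real_normK ?num_real// lerXn2r ?nnegrE//.
  exact: le_trans lF.
rewrite !big_split /= -mulr_sumr F0 mulr0 addr0 !sumr_const card_tuple -mulrnDl.
by rewrite -natrX [leRHS]mulr_natl lerMn2r expR_ge1Dx orbT.
Qed.

(** If the whole sum reaches N e, then one of the [m] residue classes of starting points reaches N e
    / m. Each class is treated by an exponential Markov bound on disjoint blocks, and the union
    bound costs the factor [m]. *)
Lemma windows_deviation (T : finType) m (F : seq T -> R) (M e : R) :
  (0 < m)%N -> (forall w, `|F w| <= M) -> \sum_(w : m.-tuple T) F w = 0 ->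
  0 < e -> exists C k : R, 0 < k /\ forall N q, (q * m + m <= N)%N ->
    #|[pred t : N.-tuple T |
        N%:R * e <= \sum_(i < q * m) F (take m (drop i t))]|%:R
    <= C * expR (- (k * N%:R)) * #|T|%:R ^+ N.
Proof.
move=> m0 FM' F0 e0; pose M' := Num.max M 1.
have M1 : 1 <= M' by rewrite /M' le_max lexx orbT.
have FM w : `|F w| <= M' by apply: le_trans (FM' w) _; rewrite le_max lexx.
have mR : 0 < m%:R :> R by rewrite ltr0n.
pose d := e / m%:R; have d0 : 0 < d by rewrite divr_gt0.
(* The first bound allows the quadratic estimate of the exponential; the second makes the quadratic
   term at most half of the gain [l * d]. *)
pose l := Num.min (2^-1 / M') (d / (4 * M' ^+ 2)).
have M0 : 0 < M' by lra.
have M20 : 0 < 4 * M' ^+ 2 by rewrite mulr_gt0// exprn_gt0.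
have l0 : 0 < l by rewrite lt_min !divr_gt0// invr_gt0.
have lM : l * M' <= 2^-1 by rewrite -ler_pdivlMr// ge_min lexx.
have ld : 2 * (l * M') ^+ 2 <= l * d / 2.
  have : l * (4 * M' ^+ 2) <= d by rewrite -ler_pdivlMr// ge_min lexx orbT.
  move=> /(ler_wpM2l (ltW l0)); rewrite exprMn; lra.
exists m%:R, (l * d / 2); split; first by rewrite divr_gt0// mulr_gt0.
move=> N q qN.
pose B r (t : N.-tuple T) := \sum_(j < q) l * F (take m (drop (r + j * m) t)).
have cardB (r : 'I_m) : #|[pred t : N.-tuple T | N%:R * (l * d) <= B r t]|%:R <=
    expR (- (l * d / 2 * N%:R)) * #|T|%:R ^+ N.
  rewrite -(ler_pM2r (expR_gt0 (N%:R * (l * d)))).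
  apply: le_trans (card_markov _ _) _; rewrite {}/B.
  have [s ->] : exists s, (N = r + (q * m + s))%N.
    exists (N - (r + q * m))%N; rewrite addnA subnKC//.
    by apply: leq_trans qN; rewrite addnC leq_add2l ltnW.
  under eq_bigr do under eq_bigr do rewrite addnC -drop_drop.
  rewrite (sum_tuple_drop _ _ (fun t =>
    expR (\sum_(j < q) l * F (take m (drop (j * m) t))))).
  rewrite (sum_expR_blocks _ _ _ (fun w => l * F w)).
  have H := sum_expR_le FM F0 (ltW l0) lM.
  apply: (@le_trans _ _ (#|T|%:R ^+ r *
    ((#|T|%:R ^+ m * expR (2 * (l * M') ^+ 2)) ^+ q * #|T|%:R ^+ s))).
    rewrite ler_wpM2l ?exprn_ge0// ler_wpM2r ?exprn_ge0//.
    by rewrite lerXn2r ?nnegrE ?mulr_ge0 ?exprn_ge0 ?expR_ge0 ?sumr_ge0//.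
  rewrite exprMn -exprM !exprD (mulnC m q) [leRHS]mulrAC -expRD.
  set a := #|T|%:R ^+ r; set b := #|T|%:R ^+ (q * m); set c := #|T|%:R ^+ s.
  rewrite (_ : a * (b * _ * c) =
    expR (2 * (l * M') ^+ 2) ^+ q * (a * (b * c))); last by ring.
  rewrite ler_wpM2r ?mulr_ge0 ?exprn_ge0// -expRM_natl ler_expR.
  apply: (@le_trans _ _ (q%:R * (l * d / 2))).
    by rewrite ler_wpM2l.
  set N' := (r + _)%N; have qN' : q%:R <= N'%:R :> R.
    by rewrite ler_nat /N' addnCA (leq_trans (leq_pmulr q m0)) ?leq_addr.
  have := ler_wpM2r (ltW (mulr_gt0 l0 d0)) qN'; lra.
apply: (@le_trans _ _ (\sum_(r < m)
    #|[pred t : N.-tuple T | N%:R * (l * d) <= B r t]|%:R)).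
  rewrite -natr_sum ler_nat -sum1_card.
  under [leqRHS]eq_bigr do rewrite -sum1_card big_mkcond.
  rewrite exchange_big /= big_mkcond; apply: leq_sum => t _.
  rewrite inE; case: ifP => //= H; rewrite -big_mkcond sum1_card.
  apply/card_gt0P; apply: contraPP H => /forallNP H; apply/negP.
  rewrite -ltNge (sum_residues m q (fun i => F (take m (drop i t)))).
  apply: (@lt_le_trans _ _ (\sum_(r < m) (N%:R * d))); last first.
    by rewrite sumr_const card_ord -[leLHS]mulr_natr -mulrA /d divfK// gt_eqF.
  apply: ltr_sum => [|r _].
    by apply/hasP; exists (Ordinal m0) => //; rewrite mem_index_enum.
  have /negP : ~ (N%:R * (l * d) <= B r t) := H r; rewrite -ltNge /B -mulr_sumr mulrCA.
  by rewrite ltr_pM2l.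
apply: (le_trans (ler_sum _ (fun r _ => cardB r))).
by rewrite sumr_const card_ord -[leRHS]mulrA [leRHS]mulr_natl.
Qed.

End deviations.

(** * Visits of a lattice path to a given height *)

Section visits.

Definition step (a : bool * bool) : int := a.1%:Z - a.2%:Z.

Fixpoint visits (k x : int) (t : seq (bool * bool)) : nat :=
  if t is a :: t' then ((x == k) + visits k (x + step a) t')%N else 0%N.

Definition endpoint (x : int) (t : seq (bool * bool)) : int :=
  x + \sum_(a <- t) step a.

Lemma endpoint_cons x a t : endpoint x (a :: t) = endpoint (x + step a) t.
Proof. by rewrite /endpoint big_cons addrA. Qed.

Variable R : realType.

Lemma sum_bool2 (F : bool * bool -> R) :
  \sum_a F a = F (true, true) + F (false, false) + F (true, false) + F (false, true).
Proof.
rewrite (eq_bigr (fun p => F (p.1, p.2))); last by case.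
by rewrite -(pair_bigA _ (fun a b => F (a, b))) /= !big_bool /=; ring.
Qed.

(* x |-> a ^ |x - k| is an eigenfunction, for the eigenvalue (1 + a) ^ 2 / a,
   of the lazy walk reweighted by (1 + a) / (2 a) at each visit of k. *)
Lemma sum_visits (a : R) (k x : int) n : 0 < a ->
  \sum_(t : n.-tuple (bool * bool))
     ((1 + a) / (2 * a)) ^+ visits k x t * a ^+ `|endpoint x t - k|%N =
  ((1 + a) ^+ 2 / a) ^+ n * a ^+ `|x - k|%N.
Proof.
move=> a0; have a0' : a != 0 by rewrite gt_eqF.
elim: n x => [|n IHn] x.
  rewrite (sum_tuple0 (fun t => ((1 + a) / (2 * a)) ^+ visits k x t *
    a ^+ `|endpoint x t - k|%N)) /=.
  by rewrite /endpoint big_nil addr0 !expr0.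
rewrite (sum_tupleS _ (fun t => ((1 + a) / (2 * a)) ^+ visits k x t *
    a ^+ `|endpoint x t - k|%N)) /=.
under eq_bigr => b _.
  under eq_bigr => t _ do rewrite endpoint_cons exprD -mulrA.
  rewrite -mulr_sumr IHn mulrCA; over.
rewrite -mulr_sumr; set rho := (1 + a) ^+ 2 / a.
rewrite exprSr -[RHS]mulrA; congr (_ * _); rewrite /rho.
rewrite sum_bool2 (_ : step (true, true) = 0)// (_ : step (false, false) = 0)//.
rewrite (_ : step (true, false) = 1)// (_ : step (false, true) = -1)// !addr0.
have [->|xk] := eqVneq x k.
  have -> : absz (k - k)%R = 0%N by lia.
  have -> : absz (k + 1 - k)%R = 1%N by lia.
  have -> : absz ((k - 1) - k)%R = 1%N by lia.
  by rewrite !expr1 !expr0; field.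
rewrite !expr0 !mul1r.
have [d [D|D]] : exists d : nat, x - k = d.+1%:Z \/ x - k = - d.+1%:Z.
  by exists `|x - k|.-1; lia.
- have -> : absz (x - k)%R = d.+1 by lia.
  have -> : absz (x + 1 - k)%R = d.+2 by lia.
  have -> : absz ((x - 1) - k)%R = d by lia.
  by rewrite !exprS; field.
- have -> : absz (x - k)%R = d.+1 by lia.
  have -> : absz (x + 1 - k)%R = d by lia.
  have -> : absz ((x - 1) - k)%R = d.+2 by lia.
  by rewrite !exprS; field.
Qed.

(** For [a = 1 - s] in [sum_visits], a visit multiplies the weight by at least [expR (s / 4)], while
    the eigenvalue exceeds 4 only by a factor of order 1 + s^2. For paths that return to 0, the
    powers of [a] at both ends cancel, so the bound has no prefactor. *)
Lemma visits_deviation (k : int) (e : R) : 0 < e ->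
  exists2 c : R, 0 < c & forall N,
    #|[pred t : N.-tuple (bool * bool) |
        (endpoint 0 t == 0) && (N%:R * e <= (visits k 0 t)%:R)]|%:R <=
    expR (- (c * N%:R)) * 4 ^+ N.
Proof.
move=> e0; pose s := Num.min (2^-1) (e / 4).
have s0 : 0 < s by rewrite lt_min divr_gt0// invr_gt0 ltr0n.
have s1 : s <= 2^-1 by rewrite ge_min lexx.
have s2 : s <= e / 4 by rewrite ge_min lexx orbT.
pose a := 1 - s; have a0 : 0 < a by rewrite /a; lra.
pose z := (1 + a) / (2 * a).
have zE : expR (s / 4) <= z.
  apply: (le_trans (expR_le_inv _)); first by lra.
  rewrite /z -div1r ler_pdivrMr; last by lra.
  rewrite mulrAC ler_pdivlMr; last by rewrite mulr_gt0.
  suff : 0 <= s * s by rewrite /a; lra.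
  by rewrite mulr_ge0// ltW.
have rE : (1 + a) ^+ 2 / a <= 4 * expR (s ^+ 2 / 2).
  apply: (@le_trans _ _ (4 * (1 + s ^+ 2 / 2))); last first.
    by rewrite ler_pM2l// expR_ge1Dx.
  rewrite ler_pdivrMr//.
  suff : 0 <= s ^+ 2 * (1 - 2 * s) by rewrite /a; lra.
  by rewrite mulr_ge0 ?sqr_ge0//; lra.
exists (s * e / 8) => [|N]; first by rewrite divr_gt0// mulr_gt0.
have := sum_visits k 0 N a0; rewrite -/z; set K := absz (0 - k)%R => sumE.
have aK : 0 < a ^+ K by rewrite exprn_gt0.
rewrite -(ler_pM2r aK) -(ler_pM2r (expR_gt0 (N%:R * e * (s / 4)))).
apply: (@le_trans _ _ (((1 + a) ^+ 2 / a) ^+ N * a ^+ K)).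
  rewrite -sumE -mulrA [leLHS]mulr_natl -sumr_const.
  rewrite [leRHS](bigID [pred t : N.-tuple (bool * bool) |
        (endpoint 0 t == 0) && (N%:R * e <= (visits k 0 t)%:R)]) /=.
  have z0 : 0 < z by apply: lt_le_trans zE; exact: expR_gt0.
  rewrite -[leLHS]addr0 lerD//; last first.
    by apply: sumr_ge0 => t _; rewrite mulr_ge0// exprn_ge0// ltW.
  apply: ler_sum => t; rewrite inE => /andP[/eqP -> H].
  rewrite mulrC ler_pM2r//; apply: (@le_trans _ _ (expR (s / 4) ^+ visits k 0 t)).
    by rewrite -expRM_natl ler_expR ler_wpM2r// divr_ge0// ltW.
  by rewrite lerXn2r// nnegrE ?expR_ge0 ?ltW.
rewrite [leRHS]mulrAC ler_pM2r// [leRHS]mulrAC -expRD.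
apply: (@le_trans _ _ ((4 * expR (s ^+ 2 / 2)) ^+ N)).
  have r0 : 0 <= (1 + a) ^+ 2 / a by rewrite divr_ge0 ?sqr_ge0// ltW.
  by rewrite lerXn2r// nnegrE ?mulr_ge0 ?expR_ge0.
rewrite exprMn -expRM_natl mulrC ler_pM2r ?exprn_gt0// ler_expR.
suff : N%:R * (s * s) <= N%:R * (s * (e / 4)) by lra.
by rewrite ler_wpM2l// ler_wpM2l// ltW.
Qed.

End visits.

(** * Averages over the positions of a 321-avoiding permutation *)

Section rare.
Variable R : realType.

(* The weight makes up for the ratio between 4 ^ N and the number of
   321-avoiding permutations of size N. *)
Definition rare (A : forall N, pred (N.-tuple (bool * bool))) : Prop :=
  (#|A N|%:R / 4 ^+ N * (N.*2.+1 * N.+1)%:R : R) @[N --> \oo] --> 0.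

Lemma rare_expR A (C c : R) : 0 < c ->
  (\forall N \near \oo, #|A N|%:R <= C * expR (- (c * N%:R)) * 4 ^+ N) -> rare A.
Proof.
(* This [d] gives d (N + 1) <= 1 + c N / 3 <= exp (c N / 3). The cube of this bound beats the
   quadratic weight and leaves a harmonic factor. *)
move=> c0 H; pose d := Num.min 1 (c / 3).
have d0 : 0 < d by rewrite lt_min ltr01 divr_gt0.
have dc : d <= c / 3 by rewrite ge_min lexx orbT.
have d1 : d <= 1 by rewrite ge_min lexx.
have expE N : (d * N.+1%:R) ^+ 3 * expR (- (c * N%:R)) <= 1.
  rewrite -ler_pdivlMr ?expR_gt0// div1r -expRN opprK.
  have -> : c * N%:R = 3%:R * (c / 3 * N%:R) by lra.
  rewrite expRM_natl lerXn2r ?nnegrE ?mulr_ge0 ?expR_ge0 ?(ltW d0)//.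
  apply: (le_trans _ (expR_ge1Dx _)); rewrite -natr1 mulrDr mulr1 addrC lerD//.
  by rewrite ler_wpM2r.
apply: (@squeeze_cvgr _ _ _ _ (cst 0) (fun N => `|C| * 2 / d ^+ 3 * harmonic N)).
- near=> N; apply/andP; split.
    by rewrite mulr_ge0// divr_ge0// exprn_ge0.
  have HN : #|A N|%:R / 4 ^+ N <= `|C| * expR (- (c * N%:R)).
    rewrite ler_pdivrMr ?exprn_gt0//.
    apply: (@le_trans _ _ (C * expR (- (c * N%:R)) * 4 ^+ N)).
      by near: N.
    by rewrite ler_wpM2r ?exprn_ge0// ler_wpM2r ?expR_ge0// ler_norm.
  apply: (@le_trans _ _ (`|C| * expR (- (c * N%:R)) * (2 * N.+1%:R ^+ 2))).
    apply: ler_pM => //.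
    by rewrite -natrX -natrM ler_nat -mul2n; nia.
  have N0 : 0 < N.+1%:R :> R by rewrite ltr0n.
  have := expE N; rewrite exprMn.
  set E := expR _ => HE.
  have {}HE : E * N.+1%:R ^+ 2 <= (d ^+ 3)^-1 * N.+1%:R^-1.
    rewrite -invfM -div1r ler_pdivlMr ?mulr_gt0 ?exprn_gt0//.
    by rewrite [leLHS](_ : _ = d ^+ 3 * N.+1%:R ^+ 3 * E)//; ring.
  rewrite /harmonic /= -[leRHS]mulrA.
  rewrite (_ : _ * (2 * _) = `|C| * 2 * (E * N.+1%:R ^+ 2)); last by ring.
  by rewrite ler_wpM2l// mulr_ge0.
- exact: cvg_cst.
- rewrite -[X in _ --> X](mulr0 (`|C| * 2 / d ^+ 3)).
  by apply: cvgMr; exact: cvg_harmonic.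
Unshelve. all: by end_near. Qed.

Lemma rareU A B : rare A -> rare B -> rare (fun N => predU (A N) (B N)).
Proof.
move=> rA rB; have := cvgD rA rB; rewrite addr0 => /(_ _) rAB.
apply: (squeeze_cvgr _ (cvg_cst 0) rAB); near=> N; apply/andP; split.
  by rewrite mulr_ge0// divr_ge0// exprn_ge0.
rewrite -mulrDl ler_wpM2r// -mulrDl ler_wpM2r ?invr_ge0 ?exprn_ge0//.
by rewrite fctE -natrD ler_nat -cardUI leq_addr.
Unshelve. all: by end_near. Qed.

(** By [record_word_inj] there are at most as many bad permutations as bad words, and
    [expn4_le_Av321] turns the division by the number of permutations into the weight of [rare]. *)
Lemma Av321_rare (A : forall N, pred (N.-tuple (bool * bool)))
    (B : forall n, pred 'S_n.+1) : rare A ->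
  (\forall n \near \oo, forall s : 'S_n.+1, s \in Av321 n.+1 -> B n s ->
     A n.+1 (record_word s)) ->
  (#|[set s in Av321 n.+1 | B n s]|%:R / #|Av321 n.+1|%:R : R) @[n --> \oo] --> 0.
Proof.
move=> rA AB; have := rA; rewrite /rare -(cvg_shiftS _ _) => {}rA.
apply: (squeeze_cvgr _ (cvg_cst 0) rA).
near=> n; apply/andP; split; first by rewrite divr_ge0.
have le1 : (#|[set s in Av321 n.+1 | B n s]| <= #|A n.+1|)%N.
  rewrite -(card_in_imset (f := @record_word n.+1)); last first.
    move=> s t; rewrite inE => /andP[sA _]; rewrite inE => /andP[tA _].
    exact: record_word_inj.
  apply: subset_leq_card; apply/fintype.subsetP => w /imsetP[s].
  rewrite inE => /andP[sA Bs] ->; move: s sA Bs; near: n.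
  exact: AB.
have Av0 : (0 < #|Av321 n.+1|)%N.
  apply: leq_trans (Av321_suffix_all n.+1) _; apply: subset_leq_card.
  by apply/fintype.subsetP => s; rewrite inE => /andP[].
rewrite ler_pdivrMr ?ltr0n//.
apply: (@le_trans _ _ #|A n.+1|%:R); first by rewrite ler_nat.
rewrite -!mulrA ler_peMr// mulrC ler_pdivlMr ?exprn_gt0// mul1r.
by rewrite -natrX -natrM ler_nat expn4_le_Av321.
Unshelve. all: by end_near. Qed.

End rare.

Lemma visitsE (k x : int) t : visits k x t =
  (\sum_(j < size t) ((x + \sum_(a <- take j t) step a)%R == k))%N.
Proof.
elim: t x => [|a t IHt] x /=; first by rewrite big_ord0.
rewrite big_ord_recl /= big_nil addr0 IHt; congr (_ + _)%N.
by apply: eq_bigr => j _; rewrite add0n big_cons (addrA x (step a)).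
Qed.

Lemma sum_step_take n (s : 'S_n) m : (m <= n)%N ->
  \sum_(a <- take m (record_word s)) step a = (overhang s m)%:Z.
Proof.
move=> mn; rewrite overhangE (big_nth (false, false)).
rewrite size_takel ?size_tuple//.
rewrite big_mkord (big_ord_widen n (fun i =>
  step (nth (false, false) (take m (record_word s)) i))) // big_mkcond.
apply: eq_bigr => i _; case: ifP => im; last by rewrite subrr.
by cbv beta; rewrite nth_take// -tnth_nth tnth_mktuple.
Qed.

Lemma endpoint_record_word n (s : 'S_n) : endpoint 0 (record_word s) = 0.
Proof.
rewrite /endpoint add0r -[X in \sum_(a <- X) _](take_size (record_word s)).
rewrite size_tuple sum_step_take// /overhang big1// => q _.
by rewrite [(n <= s q)%N]leqNgt (ltn_ord (s q)) andbF.
Qed.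

Lemma visits_record_word n (s : 'S_n) (k : nat) :
  visits k 0 (record_word s) = (\sum_(j < n) (overhang s j == k))%N.
Proof.
rewrite visitsE size_tuple; apply: eq_bigr => j _.
by rewrite add0r sum_step_take// ltnW.
Qed.

(** The letter of index [p] is placed at the integer [p - h]; what lies outside [[-h, h]] is
    arbitrary and erased by [restr h]. *)
Definition window_perm h (u : seq bool) :=
  merge_perm (fun l => nth false u (absz (l + h%:Z)%R)).

Section concentration.
Variables (R : realType) (f : rooted_perm -> R).

Definition window_mean h :=
  (\sum_(u : h.*2.+1.-tuple bool) f (window_perm h u)) / 2 ^+ h.*2.+1.

Definition local_modulus (d : R) h := forall b x,
  restr h x = restr h (merge_perm b) -> `|f x - f (merge_perm b)| <= d.

Lemma sum_tuple_fst n (F : seq bool -> R) :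
  \sum_(w : n.-tuple (bool * bool)) F (map fst w) =
  2 ^+ n * \sum_(u : n.-tuple bool) F u.
Proof.
elim: n F => [|n IHn] F.
  rewrite (sum_tuple0 (fun w => F (map fst w))) (sum_tuple0 F).
  by rewrite expr0 mul1r.
rewrite (sum_tupleS _ (fun w => F (map fst w))) (sum_tupleS _ F).
under eq_bigr => a _ do rewrite (IHn (fun u => F (a.1 :: u))).
rewrite sum_bool2 /= !big_bool exprS /=; ring.
Qed.

Definition centered h (w : seq (bool * bool)) :=
  f (window_perm h (map fst w)) - window_mean h.

Lemma sum_centered h :
  \sum_(w : h.*2.+1.-tuple (bool * bool)) centered h w = 0.
Proof.
rewrite sumrB (sum_tuple_fst _ (fun u => f (window_perm h u))).
rewrite sumr_const card_tuple card_prod card_bool /window_mean.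
rewrite -[X in _ - X]mulr_natr natrX natrM exprMn.
by rewrite mulrA divfK ?expf_neq0// mulrC subrr.
Qed.

Variable M : R.
Hypothesis fM : forall x, `|f x| <= M.

Lemma window_mean_le h : `|window_mean h| <= M.
Proof.
rewrite normrM normfV [X in _ / X]ger0_norm ?exprn_ge0//.
rewrite ler_pdivrMr ?exprn_gt0//; apply: le_trans (ler_norm_sum _ _ _) _.
apply: (@le_trans _ _ (\sum_(u : h.*2.+1.-tuple bool) M)); first exact: ler_sum.
by rewrite sumr_const card_tuple card_bool -natrX [leRHS]mulr_natr.
Qed.

Lemma centered_le h w : `|centered h w| <= 2 * M.
Proof.
apply: le_trans (ler_normB _ _) _; have := window_mean_le h.
by have := fM (window_perm h (map fst w)); lra.
Qed.

Lemma finite_rooted_window n (s : 'S_n.+1) (i : 'I_n.+1) h d :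
  local_modulus d h -> s \in Av321 n.+1 -> (h <= i)%N -> (i + h <= n)%N ->
  (h.+1 < overhang s i)%N ->
  `|f (finite_rooted s i) -
    f (window_perm h (map fst (take h.*2.+1 (drop (i - h) (record_word s)))))| <= d.
Proof.
move=> fd sA hi ih ov; apply: fd; apply: restr_finite_rooted => // p ip pi.
have -> : absz (p%:Z - i%:Z + h%:Z)%R = (p + h - i)%N by lia.
have ph : (p + h - i < h.*2.+1)%N by lia.
rewrite (nth_map (false, false)); last first.
  by rewrite size_take size_drop size_tuple; have := ltn_ord p; case: ifP; lia.
rewrite nth_take// nth_drop.
have -> : (i - h + (p + h - i) = p)%N by lia.
by rewrite -tnth_nth tnth_mktuple.
Qed.

(** A position costs [d] when its overhang exceeds [h.+1], since its window is then a merge, and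
    [2 * M] otherwise. Positions of small overhang are visits to the heights 0, ..., h + 1; the last
    term is for positions near the ends. *)
Lemma sum_finite_rooted n (s : 'S_n.+1) h q d :
  0 <= d -> local_modulus d h -> s \in Av321 n.+1 ->
  (q * h.*2.+1 + h.*2.+1 <= n.+1)%N ->
  `|\sum_(i < n.+1) f (finite_rooted s i) - n.+1%:R * window_mean h| <=
  `|\sum_(j < q * h.*2.+1) centered h (take h.*2.+1 (drop j (record_word s)))| +
  n.+1%:R * d + 2 * M * (\sum_(k < h.+2) visits k 0 (record_word s))%:R +
  2 * M * (n.+1 - q * h.*2.+1)%:R.
Proof.
move=> d0 fd sA; set m := h.*2.+1; set L := (q * m)%N => qn.
have {}qn : (L + h.*2.+1 <= n.+1)%N by exact: qn.
move: (L) qn => {q}L qn.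
have M0 : 0 <= M by apply: le_trans (fM (finite_rooted s ord0)).
pose c (i : nat) := centered h (take m (drop (i - h) (record_word s))).
(* Centres of the windows starting at 0, ..., L - 1. *)
pose I (i : nat) := (h <= i)%N && (i < L + h)%N.
have cE : \sum_(j < L) centered h (take m (drop j (record_word s))) =
    \sum_(i < n.+1 | I i) c i.
  rewrite (eq_bigr (fun j : 'I_L => c (j + h)%N)); last first.
    by move=> j _; rewrite /c addnK.
  rewrite -(big_mkord xpredT (fun j => c (j + h)%N)).
  have -> : \sum_(0 <= j < L) c (j + h)%N = \sum_(h <= i < L + h) c i.
    by rewrite -{2}[h]add0n big_addn addnK.
  rewrite -(big_mkord I c) [RHS](@big_cat_nat _ _ _ h)//=; last by lia.
  rewrite [X in _ = X + _]big_nat_cond [X in _ = X + _]big1 ?add0r; last first.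
    by move=> i; rewrite /I => /andP[/andP[_ ?] /andP[? _]]; lia.
  rewrite [RHS](@big_cat_nat _ _ _ (L + h))//=; [|lia|lia].
  rewrite [X in _ = _ + X]big_nat_cond [X in _ = _ + X]big1 ?addr0; last first.
    by move=> i; rewrite /I => /andP[/andP[? _] /andP[_ ?]]; lia.
  rewrite [LHS]big_nat_cond [RHS]big_nat_cond; apply: eq_bigl => i.
  by rewrite /I andbT; case: (h <= i)%N => //=; rewrite andbb.
have cardI : (\sum_(i < n.+1) ~~ I i <= n.+1 - L)%N.
  apply: (@leq_trans (\sum_(i < n.+1)
      ((i < h) + ((L + h <= i) && (i < n.+1))))).
    apply: leq_sum => i _; rewrite /I ltn_ord andbT.
    by case: (leqP h i); case: (ltnP i (L + h)).
  rewrite big_split /= sum_ord_ltn; last by lia.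
  have := sum_ord_itv n.+1 (L + h) n.+1.
  by set S := (\sum_(_ < _) _)%N; lia.
have vE : (\sum_(k < h.+2) visits k 0 (record_word s) =
    \sum_(i < n.+1) (overhang s i <= h.+1))%N.
  under eq_bigr do rewrite visits_record_word.
  rewrite exchange_big /=; apply: eq_bigr => i _.
  case: leqP => oh; last first.
    by rewrite big1// => k _; case: eqP => // e; have := ltn_ord k; lia.
  rewrite (bigD1 (Ordinal (oh : (overhang s i < h.+2)%N)))//= eqxx big1// => k.
  by rewrite -(inj_eq val_inj) /= eq_sym => /negPf ->.
rewrite cE vE.
have -> : \sum_(i < n.+1) f (finite_rooted s i) - n.+1%:R * window_mean h =
   \sum_(i < n.+1 | I i) c i + \sum_(i < n.+1)
     (f (finite_rooted s i) - window_mean h - if I i then c i else 0).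
  rewrite [X in _ = X + _]big_mkcond -big_split /=.
  under [RHS]eq_bigr do rewrite addrCA subrr addr0.
  by rewrite sumrB sumr_const card_ord mulr_natl.
apply: le_trans (ler_normD _ _) _; rewrite -!addrA lerD2l.
apply: le_trans (ler_norm_sum _ _ _) _.
apply: (@le_trans _ _ (\sum_(i < n.+1)
    (d + (2 * M * (overhang s i <= h.+1)%:R + 2 * M * (~~ I i)%:R)))).
  apply: ler_sum => i _; case: ifP => /= Ii; last first.
    rewrite subr0 mulr1 addrA; apply: ler_wpDl.
      by rewrite addr_ge0// mulr_ge0// mulr_ge0.
    by apply: le_trans (ler_normB _ _) _; have := fM (finite_rooted s i);
      have := window_mean_le h; lra.
  rewrite mulr0 addr0 /c /centered opprB addrA subrK.
  case: leqP => /= oh.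
    rewrite mulr1; apply: ler_wpDl => //; apply: le_trans (ler_normB _ _) _.
    by have := fM (finite_rooted s i); set z := window_perm _ _;
      have := fM z; lra.
  rewrite mulr0 addr0; move/andP: Ii => [hi iL].
  by apply: finite_rooted_window => //; lia.
rewrite !big_split /= sumr_const card_ord -(mulr_natl d) lerD2l -!mulr_sumr -!natr_sum.
by rewrite lerD2l ler_wpM2l ?mulr_ge0// ler_nat.
Qed.

End concentration.

Section average.
Variable R : realType.

Lemma rare_has (r : seq nat) (V : nat -> forall N, pred (N.-tuple (bool * bool))) :
  (forall k, rare R (V k)) -> rare R (fun N t => has (fun k => V k N t) r).
Proof.
move=> rV; elim: r => [|k r IHr]; last exact: rareU.
rewrite /rare.
have -> : (fun N => #|(fun t : N.-tuple (bool * bool) =>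
    has (fun k => V k N t) [::])|%:R / 4 ^+ N * (N.*2.+1 * N.+1)%:R) = cst 0 :> (nat -> R).
  by apply/funext => N; rewrite (eq_card0 (fun=> erefl)) mul0r mul0r.
exact: cvg_cst.
Qed.

(** Outside three rare events, namely a window sum too large, one too small, and too many visits to
    a low height, each of the four error terms of [sum_finite_rooted] is at most N e / 8. Together
    they give e / 2, and [window_mean] is within e / 8 of [I]. *)
Lemma average_concentration (f : rooted_perm -> R) (M I e : R) :
  (forall x, `|f x| <= M) ->
  (forall d, 0 < d -> exists h, local_modulus f d h /\ `|window_mean f h - I| <= d) ->
  0 < e ->
  (#|[set s in Av321 n.+1 |
       e <= `|(\sum_(i < n.+1) f (finite_rooted s i)) / n.+1%:R - I|]|%:R /
   #|Av321 n.+1|%:R : R) @[n --> \oo] --> 0.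
Proof.
move=> fM' fI e0; pose M' := Num.max M 1.
have fM x : `|f x| <= M' by rewrite (le_trans (fM' x))// le_max lexx.
have M1 : 1 <= M' by rewrite le_max lexx orbT.
have e8 : 0 < e / 8 by rewrite divr_gt0.
have [h [fh mI]] := fI _ e8; set m := h.*2.+1 in fh mI *.
have [C1 [k1 [k10 D1]]] := windows_deviation (isT : (0 < h.*2.+1)%N)
  (centered_le fM h) (sum_centered f h) e8.
have [C2 [k2 [k20 D2]]] := @windows_deviation R _ h.*2.+1
  (fun w => - centered f h w) (2 * M') (e / 8) isT
  (fun w => etrans (congr1 (fun x => x <= _) (normrN _)) (centered_le fM h w))
  (etrans (sumrN _ _ _) (etrans (congr1 -%R (sum_centered f h)) (oppr0 _))) e8.
(* One block is given up so that every window starting before [q N * m] fits in the word. *)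
pose q N := (N %/ m).-1.
have qm N : (m <= N)%N -> (q N * m + m <= N)%N.
  move=> mN; rewrite -mulSnr /q prednK; first exact: leq_trunc_div.
  by rewrite divn_gt0.
have qM N : (N - q N * m <= 2 * m)%N.
  rewrite /q {1}(divn_eq N m); have := ltn_pmod N (isT : (0 < m)%N).
  by case: (N %/ m)%N => [|a] /=; rewrite ?mulSn; lia.
(* Chosen so that [eta * N] visits to each of the [h.+2] low heights, at cost [2 * M'] each, amount
   to N e / 8. *)
pose eta := e / (16 * M' * h.+2%:R).
have h20 : 0 < h.+2%:R :> R by rewrite ltr0n.
have eta0 : 0 < eta by rewrite divr_gt0// mulr_gt0// mulr_gt0//; lra.
pose S N (t : N.-tuple (bool * bool)) :=
  \sum_(i < q N * m) centered f h (take m (drop i t)).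
pose A1 N (t : N.-tuple (bool * bool)) := N%:R * (e / 8) <= S N t.
pose A2 N (t : N.-tuple (bool * bool)) := N%:R * (e / 8) <= - S N t.
pose V (k : nat) N (t : N.-tuple (bool * bool)) :=
  (endpoint 0 t == 0) && (N%:R * eta <= (visits k 0 t)%:R).
pose A N (t : N.-tuple (bool * bool)) :=
  A1 N t || (A2 N t || has (fun k => V k N t) (iota 0 h.+2)).
have c4 : #|{: bool * bool}|%:R = 4 :> R by rewrite card_prod card_bool.
have rA : rare R A.
  apply: rareU; last apply: rareU.
  - apply: (rare_expR (C := C1) k10); near=> N.
    by rewrite -c4; apply: D1; apply: qm; near: N; exact: nbhs_infty_ge.
  - apply: (rare_expR (C := C2) k20); near=> N.
    rewrite -c4; apply: le_trans (D2 N (q N) _); last first.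
      by apply: qm; near: N; exact: nbhs_infty_ge.
    rewrite ler_nat; apply: subset_leq_card; apply/fintype.subsetP => t.
    by rewrite !inE unfold_in /A2 /S -sumrN.
  - apply: rare_has => k; have [c c0 Hc] := visits_deviation k%:Z eta0.
    apply: (rare_expR (C := 1) c0); near=> N; rewrite mul1r; exact: Hc.
apply: (Av321_rare rA); near=> n => s sA eB.
apply/negPn/negP; rewrite /A negb_or => /andP[nA1]; rewrite negb_or => /andP[nA2 nhV].
have nV k : (k < h.+2)%N -> ~~ V k n.+1 (record_word s).
  by move=> kh; apply: contra nhV => Vk; apply/hasP; exists k; rewrite ?mem_iota.
set N := n.+1 in nA1 nA2 nV *.
have N0 : 0 < N%:R :> R by rewrite ltr0n.
have SN : `|S N (record_word s)| <= N%:R * (e / 8).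
  by rewrite ler_norml lerNl; move: nA1 nA2; rewrite /A1 /A2 -!ltNge => /ltW -> /ltW ->.
have VN : 2 * M' * (\sum_(k < h.+2) visits k 0 (record_word s))%:R <= N%:R * (e / 8).
  apply: (@le_trans _ _ (2 * M' * (\sum_(k < h.+2) N%:R * eta))).
    rewrite natr_sum ler_wpM2l//; first by rewrite mulr_ge0//; lra.
    apply: ler_sum => k _; have := nV k (ltn_ord k); rewrite /V.
    by rewrite endpoint_record_word eqxx /= -ltNge => /ltW.
  rewrite sumr_const card_ord -[_ *+ _]mulr_natl /eta le_eqVlt; apply/orP; left; apply/eqP.
  by field; apply/andP; split; lra.
have HS := @sum_finite_rooted R f M' fM n s h (q N) (e / 8) (ltW e8) fh sA.
have {}HS := HS (qm _ _).
have mN : (m <= N)%N.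
  by rewrite /N; near: n; exists m => // k /= mk; rewrite leqW.
have {}HS := HS mN.
have qN : 2 * M' * (N - q N * m)%:R <= N%:R * (e / 8).
  apply: (@le_trans _ _ (2 * M' * (2 * m)%:R)).
    by rewrite ler_wpM2l ?ler_nat//; lra.
  rewrite -ler_pdivrMr//; apply: (@le_trans _ _ n%:R); last by rewrite ler_nat.
  by near: n; exact: nbhs_infty_ger.
move: eB; apply/negP; rewrite -ltNge.
set T := \sum_(i < n.+1) _ in HS *.
have TN : T / N%:R - I = (T - N%:R * window_mean f h) / N%:R + (window_mean f h - I).
  by field; rewrite gt_eqF.
rewrite TN; apply: le_lt_trans (ler_normD _ _) _.
have : `|(T - N%:R * window_mean f h) / N%:R| <= e / 2.
  rewrite normrM normfV [X in _ / X]gtr0_norm// ler_pdivrMr//.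
  apply: (le_trans HS); apply: (le_trans (lerD (lerD (lerD SN (lexx _)) VN) qN)).
  by rewrite -/N; lra.
by move: mI e0; lra.
Unshelve. all: by end_near. Qed.

End average.

(** * Topology of rooted permutations *)

Section local_topology.
Variable R : realType.
Implicit Types x y : rooted_space R.

Lemma local_dist_restr h x y : (0 < h)%N -> restr h x = restr h y ->
  local_dist R x y <= 2 ^- h.
Proof.
move=> h0 xy; apply: le_trans (exp2N_le _ (agreement_ge R h0 xy)) _ => //=.
by rewrite powRN powR_mulrn.
Qed.

Lemma nbhs_restr x (A : set (rooted_space R)) : nbhs x A ->
  exists h, forall y, restr h y = restr h x -> A y.
Proof.
rewrite -nbhs_ballE => -[e /= e0 xA].
have [h _ he] : \forall h \near \oo, (2 : R) ^- h < e.
  have : (2^-1 : R) ^+ n @[n --> \oo] --> 0.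
    by apply: cvg_expr; rewrite ger0_norm ?invf_lt1 ?ltr1n.
  move=> /cvgr0Pnorm_lt /(_ e e0); apply: filterS => h.
  by rewrite exprVn ger0_norm// invr_ge0 exprn_ge0.
exists h.+1 => y yx; apply: xA; rewrite ballEmdist /=.
apply: le_lt_trans (local_dist_restr (isT : (0 < h.+1)%N) (esym yx)) _.
by apply: he => /=; exact: leqnSn.
Qed.

Lemma continuous_restr (f : rooted_space R -> R) x (d : R) : continuous f -> 0 < d ->
  exists h, forall y, restr h y = restr h x -> `|f y - f x| < d.
Proof.
move=> cf d0; have /cvgrPdistC_lt/(_ d d0) := cf x.
exact: nbhs_restr.
Qed.

Lemma nbhs_cylinder (b : {ptws int -> bool}) k :
  nbhs b [set b' : {ptws int -> bool} | forall l : int, - k%:Z <= l <= k%:Z -> b' l = b l].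
Proof.
have nb1 l : nbhs b [set b' : {ptws int -> bool} | b' l = b l].
  have := @proj_continuous int (fun=> bool) l b [set b l].
  by apply; exact: discrete_set1.
elim: k => [|k IHk].
  apply: filterS (nb1 0) => b' b'0 l l0; have -> : l = 0 by lia.
  by [].
apply: filterS (filterI IHk (filterI (nb1 k.+1%:Z) (nb1 (- k.+1%:Z)))).
move=> b' /= [bk [b1 b2]] l lk.
have [->//|l1] := eqVneq l k.+1%:Z.
have [->//|l2] := eqVneq l (- k.+1%:Z).
by apply: bk; lia.
Qed.

Lemma restr_le k h (x y : rooted_perm) : (k <= h)%N -> restr h x = restr h y ->
  restr k x = restr k y.
Proof. by move=> kh xy; rewrite -(restr_restr x kh) xy restr_restr. Qed.

(* Compactness of the space of two-sided binary words. *)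
Lemma continuous_local_modulus (f : rooted_space R -> R) (d : R) :
  continuous f -> 0 < d -> exists h, local_modulus f d h.
Proof.
move=> cf d0; apply: contrapT => /forallNP nH.
have /choice[B HB] : forall h, exists b : {ptws int -> bool}, exists x : rooted_perm,
    restr h x = restr h (merge_perm b) /\ d < `|f x - f (merge_perm b)|.
  move=> h; apply: contrapT => /forallNP nb; apply: (nH h) => b x bx.
  rewrite leNgt; apply/negP => dx; apply: (nb b); by exists x.
have cpt : compact [set: {ptws int -> bool}].
  have := @tychonoff int (fun=> bool) (fun=> setT) (fun=> bool_compact).
  by congr (compact _); rewrite eqEsubset.
(* At a cluster point [b] of the counterexamples, continuity gives a radius [k] within which [f]
   varies by less than d / 2 from its value at the merge. For some [h >= k], both members of the
   counterexample agree with that merge on radius [k], hence differ by less than [d] under [f]. *)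
have [b [_ clb]] := cpt (B @ \oo) _ filterT.
have d2 : 0 < d / 2 by rewrite divr_gt0.
have [k fk] := continuous_restr (merge_perm b) cf d2.
have Bk : (B @ \oo) [set B h | h in [set h | (k <= h)%N]].
  by exists k => // h /= kh; exists h.
have [_ [[h /= kh <-] bh]] := clb _ _ Bk (nbhs_cylinder b k).
have [x [xh]] := HB h; apply/negP; rewrite -leNgt.
have hb : restr k (merge_perm (B h)) = restr k (merge_perm b) by exact: restr_merge_perm.
have := fk _ hb; have := fk x (etrans (restr_le kh xh) hb).
rewrite !ltr_norml ler_norml; lra.
Qed.

Lemma continuous_measurable_borel (f : rooted_space R -> R) : continuous f ->
  measurable_fun [set: borel (rooted_space R)] (f : borel (rooted_space R) -> R).
Proof.
move=> /continuousP cf; apply: (measurability _ (RGenOpens.measurableE R)).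
move=> _ [_ [a [b ->] <-]]; rewrite setTI; apply: sub_sigma_algebra.
by apply: cf; exact: interval_open.
Qed.

End local_topology.

(** * The limit law *)

Section probability_integrals.
Context d (T : measurableType d) (R : realType) (P : probability T R).

Lemma bounded_integrable (f : T -> R) (M : R) :
  measurable_fun setT f -> (forall x, `|f x| <= M) ->
  P.-integrable setT (EFin \o f).
Proof.
move=> mf fM; apply: measurable_bounded_integrable => //.
  exact: fin_num_fun_lty.
exists M; split; first exact: num_real.
by move=> y My x _ /=; rewrite (le_trans (fM x))// ltW.
Qed.

Lemma Rintegral_prob_cst (r : R) : \int[P]_x r = r.
Proof. by rewrite /Rintegral integral_cst//= probability_setT mule1. Qed.

Lemma Rintegral_sum_indic n (a : nat -> R) (A : nat -> set T) :
  (forall j, measurable (A j)) ->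
  P.-integrable setT (EFin \o (fun x => \sum_(j < n) a j * \1_(A j) x)) /\
  \int[P]_x (\sum_(j < n) a j * \1_(A j) x) = \sum_(j < n) a j * fine (P (A j)).
Proof.
move=> mA; elim: n => [|n [IHi IHn]].
  have e : (fun x => \sum_(j < 0) a j * \1_(A j) x) = cst (0 : R) :> (T -> R).
    by apply/funext => x; rewrite big_ord0.
  by rewrite e Rintegral_prob_cst big_ord0; split => //; exact: integrable0.
have i1 : P.-integrable setT (EFin \o (fun x => a n * \1_(A n) x)).
  exact: (integrableZl _ (a n) (integrable_indic P (mA n))).
have e : (fun x => \sum_(j < n.+1) a j * \1_(A j) x) =
    (fun x => \sum_(j < n) a j * \1_(A j) x + a n * \1_(A n) x) :> (T -> R).
  by apply/funext => x; rewrite big_ord_recr.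
rewrite e big_ord_recr /=; split; first exact: (integrableD measurableT IHi i1).
rewrite RintegralD// IHn RintegralZl//; last exact: integrable_indic.
by rewrite /Rintegral integral_indic// setIT.
Qed.

End probability_integrals.

Section unit_law.
Variable R : realType.

Definition unit_law : set (measurableTypeR R) -> \bar R :=
  mrestr (@lebesgue_measure R)
    (measurable_itv `[0, 1[ : measurable (`[0, 1[%classic : set R)).

HB.instance Definition _ := Measure.on unit_law.

Let unit_law_setT : unit_law setT = 1%E.
Proof.
by rewrite /unit_law /mrestr setTI lebesgue_measure_itv /= lte_fin ltr01 oppr0 adde0.
Qed.

HB.instance Definition _ := Measure_isProbability.Build _ _ _ unit_law unit_law_setT.

Definition digit (x : R) k := odd (Num.truncn (2 ^+ k.+1 * x)).

(* The integers of [-h, h] receive the codes 0, ..., 2h, so that the first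
   2h + 1 digits determine the window of radius h. *)
Definition int_code (l : int) : nat :=
  match l with Posz n => n.*2 | Negz n => n.*2.+1 end.

Lemma int_code_le h (l : int) : - h%:Z <= l <= h%:Z -> (int_code l <= h.*2)%N.
Proof. by case: l => n /=; lia. Qed.

Lemma int_code_surj h k : (k <= h.*2)%N ->
  exists2 p, (p < h.*2.+1)%N & int_code (p%:Z - h%:Z) = k.
Proof.
move=> kh; have [ok|ek] := boolP (odd k).
  exists (h - k./2.+1)%N; first by lia.
  have -> : (h - k./2.+1)%N%:Z - h%:Z = Negz k./2 by lia.
  by rewrite /=; lia.
exists (h + k./2)%N; first by lia.
have -> : (h + k./2)%N%:Z - h%:Z = Posz k./2 by lia.
by rewrite /=; lia.
Qed.

Definition limit_perm (x : R) := merge_perm (fun l => digit x (int_code l)).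

(** For [j] the integer part of 2^(2h+1) x, the digit of [x] of index [k] is the bit of [j] of
    weight 2^(2h-k). *)
Definition dyadic_word h j :=
  mkseq (fun p => odd (j %/ 2 ^ (h.*2 - int_code (p%:Z - h%:Z)))) h.*2.+1.

Lemma truncn_divn (y : R) e : (0 < e)%N ->
  (Num.truncn (e%:R * y) %/ e)%N = Num.truncn y.
Proof.
move=> e0; have eR : 0 < e%:R :> R by rewrite ltr0n.
have [y0|y0] := leP 0 y; last first.
  have trunc0 (z : R) : z < 0 -> Num.truncn z = 0%N.
    by move=> z0; apply/eqP; rewrite -leqn0 truncn_le_nat (lt_trans z0).
  by rewrite !trunc0 ?div0n// pmulr_rlt0.
apply/esym/truncn_def; set j := Num.truncn _.
have /andP[j1 j2] : j%:R <= e%:R * y < j.+1%:R by apply/truncn_itv/mulr_ge0.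
apply/andP; split.
  rewrite -(ler_pM2l eR); apply: le_trans j1; rewrite -natrM ler_nat mulnC.
  exact: leq_trunc_div.
rewrite -(ltr_pM2l eR); apply: lt_le_trans j2 _; rewrite -natrM ler_nat mulnC.
exact: ltn_ceil.
Qed.

Lemma restr_limit_perm h x : restr h (limit_perm x) =
  restr h (window_perm h (dyadic_word h (Num.truncn (2 ^+ h.*2.+1 * x)))).
Proof.
apply: restr_merge_perm => l lh; have ch := int_code_le lh.
rewrite nth_mkseq; last by lia.
have -> : (absz (l + h%:Z)%R)%:Z - h%:Z = l by lia.
rewrite /digit; congr odd.
rewrite -(@truncn_divn (2 ^+ (int_code l).+1 * x) (2 ^ (h.*2 - int_code l))) ?expn_gt0//.
rewrite natrX mulrA -exprD; congr (_ %/ _)%N; congr (Num.truncn (2 ^+ _ * x)).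
by lia.
Qed.

Lemma eq_binary_digits m j j' : (j < 2 ^ m)%N -> (j' < 2 ^ m)%N ->
  (forall e, (e < m)%N -> odd (j %/ 2 ^ e) = odd (j' %/ 2 ^ e)) -> j = j'.
Proof.
elim: m j j' => [|m IHm] j j'; first by rewrite expn0; lia.
rewrite expnS => jm j'm H; have := H 0%N isT; rewrite expn0 !divn1 => o0.
have : (j %/ 2 = j' %/ 2)%N.
  apply: IHm; [lia|lia|move=> e em].
  by have := H e.+1 em; rewrite expnS !divnMA.
by lia.
Qed.

(** The letters of the word are the binary digits of [j] in another order, so distinct [j] give
    distinct words; equal cardinalities make this a bijection. *)
Lemma sum_dyadic_word h (F : seq bool -> R) :
  \sum_(j < 2 ^ h.*2.+1) F (dyadic_word h j) = \sum_(u : h.*2.+1.-tuple bool) F u.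
Proof.
pose W (j : 'I_(2 ^ h.*2.+1)) : h.*2.+1.-tuple bool := [tuple of dyadic_word h j].
have W_inj : injective W.
  move=> i j /(congr1 val) /= ij; apply: val_inj => /=.
  apply: (eq_binary_digits (ltn_ord i) (ltn_ord j)) => e em.
  have [p pm pe] := @int_code_surj h (h.*2 - e) (leq_subr _ _).
  have := congr1 (fun u => nth false u p) ij.
  by rewrite !nth_mkseq// pe subKn.
have W_bij : bijective W.
  by apply: inj_card_bij => //; rewrite card_tuple card_bool card_ord.
by rewrite (reindex W) //=; exact: onW_bij.
Qed.

Lemma measurable_truncn (c : R) (S : set nat) : 0 < c ->
  measurable [set x : R | S (Num.truncn (c * x))].
Proof.
move=> c0; have le_meas n : measurable [set x : R | (Num.truncn (c * x) <= n)%N].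
  have -> : [set x : R | (Num.truncn (c * x) <= n)%N] = `]-oo, (n.+1%:R / c)[%classic.
    by apply/seteqP; split => x /=; rewrite in_itv /= truncn_le_nat ltr_pdivlMr// mulrC.
  exact: measurable_itv.
(* The guard [n > 0] prevents the removal of the level 0 itself when [n = 0], as [0.-1 = 0]. *)
have -> : [set x : R | S (Num.truncn (c * x))] = \bigcup_(n in S)
    ([set x : R | (Num.truncn (c * x) <= n)%N] `\`
     [set x : R | (n > 0)%N /\ (Num.truncn (c * x) <= n.-1)%N]).
  apply/seteqP; split => [x /= Sx|x [n /= Sn [/= xn xn']]].
    by exists (Num.truncn (c * x)) => //=; split => //= -[]; lia.
  suff -> : Num.truncn (c * x) = n by [].
  apply/eqP; rewrite eqn_leq xn /= leqNgt; apply/negP => nx; apply: xn'; lia.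
apply: bigcup_measurable => n _; apply: measurableD => //.
case: n => [|n].
  by rewrite (_ : [set x | _] = set0)//; apply/seteqP; split => // x [].
rewrite (_ : [set x | _] = [set x : R | (Num.truncn (c * x) <= n)%N])//.
by apply/seteqP; split => x /=; [case|].
Qed.

(** A point belongs to an open set as soon as some window forces it, and a window of the limit
    depends on finitely many digits: the preimage is a countable union of dyadic events. *)
Lemma measurable_limit_perm : measurable_fun [set: measurableTypeR R]
  (limit_perm : measurableTypeR R -> borel (rooted_space R)).
Proof.
apply: (@measurability _ _ (measurableTypeR R) (borel (rooted_space R)) setT
  limit_perm (@open (rooted_space R))) => // _ [U oU <-].
rewrite setTI; pose S h : set nat := [set j | forall y : rooted_space R,
  restr h y = restr h (window_perm h (dyadic_word h j)) -> U y].
have -> : limit_perm @^-1` U =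
    \bigcup_h [set x : R | S h (Num.truncn (2 ^+ h.*2.+1 * x))].
  apply/seteqP; split => x /=.
    move=> Ux; have [h hU] := nbhs_restr (open_nbhs_nbhs (conj oU Ux)).
    by exists h => // y yx; apply: hU; rewrite yx -restr_limit_perm.
  by move=> [h _ /=]; apply; exact: restr_limit_perm.
by apply: bigcupT_measurable => h; apply: measurable_truncn; rewrite exprn_gt0.
Qed.

HB.instance Definition _ := isMeasurableFun.Build _ _ _ _
  (limit_perm : measurableTypeR R -> borel (rooted_space R)) measurable_limit_perm.

End unit_law.

Section limit_law.
Variable R : realType.

Lemma Rintegral_limit_perm_le (f : rooted_space R -> R) (M d : R) h :
  continuous f -> (forall x, `|f x| <= M) -> local_modulus f d h ->
  \int[@unit_law R]_x f (limit_perm x) <= window_mean f h + d.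
Proof.
move=> cf fM fd; pose m := h.*2.+1; pose J (x : R) := Num.truncn (2 ^+ m * x).
(* The index 2^m stands for the complement of [[0, 1)], which is null; there [f] is bounded by [M].
   The other pieces are the dyadic intervals, on which the window is constant. *)
pose A (j : nat) : set (measurableTypeR R) :=
  if (j < 2 ^ m)%N then `[0, 1[%classic `&` [set x | J x = j]
  else ~` `[0, 1[%classic.
pose a (j : nat) : R :=
  if (j < 2 ^ m)%N then f (window_perm h (dyadic_word h j)) + d else M.
have m0 : 0 < 2 ^+ m :> R by rewrite exprn_gt0.
have mA j : measurable (A j).
  rewrite /A; case: ifP => _; last by apply: measurableC; exact: measurable_itv.
  apply: measurableI; first exact: measurable_itv.
  exact: (@measurable_truncn R _ [set j]).
have [iH eH] := @Rintegral_sum_indic _ _ R (@unit_law R) (2 ^ m).+1 a A mA.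
have J_lt x : (`[0, 1[%classic : set R) x -> (J x < 2 ^ m)%N.
  rewrite /= in_itv /= => /andP[x0 x1].
  by rewrite truncn_lt_nat ?mulr_ge0 ?(ltW m0)// natrX gtr_pMr.
apply: (@le_trans _ _ (\int[@unit_law R]_x (\sum_(j < (2 ^ m).+1) a j * \1_(A j) x))).
  apply: le_Rintegral => //.
    apply: (@bounded_integrable _ _ _ _ _ M) => // .
    apply: (measurableT_comp (continuous_measurable_borel cf)).
    exact: measurable_limit_perm.
  move=> x _; have [x01|x01] := pselect ((`[0, 1[%classic : set R) x).
    have Jx := J_lt x x01.
    pose j0 : 'I_(2 ^ m).+1 := Ordinal (ltnW Jx : (J x < (2 ^ m).+1)%N).
    rewrite (bigD1 j0) //= big1 ?addr0; last first.
      move=> i iJ; rewrite indicE memNset ?mulr0// /A; case: ifP => _; last exact.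
      by move=> -[_ /= Ji]; move/eqP: iJ; apply; exact: val_inj.
    rewrite indicE mem_set; last by rewrite /A Jx; split.
    rewrite mulr1 /a Jx -lerBlDl; apply: le_trans (ler_norm _) _.
    exact/fd/restr_limit_perm.
  rewrite big_ord_recr /= big1 ?add0r; last first.
    by move=> i _; rewrite indicE memNset ?mulr0// /A ltn_ord => -[].
  rewrite indicE mem_set; last by rewrite /A ltnn.
  by rewrite mulr1 /a ltnn (le_trans (ler_norm _)).
rewrite eH big_ord_recr /=.
have -> : unit_law (A (2 ^ m)%N) = 0%E.
  by rewrite /unit_law /mrestr /A ltnn setICl measure0.
rewrite mulr0 addr0.
have PA (j : 'I_(2 ^ m)) : fine (unit_law (A j)) = 2 ^- m.
  rewrite /unit_law /mrestr /A ltn_ord.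
  have -> : `[0, 1[ `&` [set x | J x = j] `&` `[0, 1[ =
      `[j%:R / 2 ^+ m, j.+1%:R / 2 ^+ m[%classic.
    apply/seteqP; split => x /=; rewrite !in_itv /=.
      move=> [[/andP[x0 x1] Jx] _].
      have : 0 <= 2 ^+ m * x by rewrite mulr_ge0// ltW.
      by move=> /truncn_itv; rewrite -/(J x) Jx ler_pdivrMr// ltr_pdivlMr// mulrC.
    rewrite ler_pdivrMr// ltr_pdivlMr// mulrC => jx.
    have x0 : 0 <= x.
      by move: jx => /andP[jx _]; rewrite -(pmulr_rge0 _ m0) (le_trans _ jx).
    have x1 : x < 1.
      move: jx => /andP[_ jx]; rewrite -(ltr_pM2l m0) (lt_le_trans jx)// mulr1.
      by rewrite -natrX ler_nat.
    by rewrite x0 x1; split => //; split => //; exact: truncn_def.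
  rewrite lebesgue_measure_itv /= lte_fin ltr_pM2r ?invr_gt0// ltr_nat ltnSn /=.
  by rewrite -mulrBl -natrB// subSnn mul1r.
under eq_bigr => j _ do rewrite PA /a ltn_ord.
rewrite -mulr_suml big_split /= (sum_dyadic_word h (fun u => f (window_perm h u))).
rewrite mulrDl sumr_const card_ord -[d *+ _]mulr_natr natrX mulfK ?gt_eqF//.
Qed.

Lemma Rintegral_limit_perm (f : rooted_space R -> R) (M d : R) h :
  continuous f -> (forall x, `|f x| <= M) -> local_modulus f d h ->
  `|window_mean f h - \int[@unit_law R]_x f (limit_perm x)| <= d.
Proof.
move=> cf fM fd; have H1 := Rintegral_limit_perm_le cf fM fd.
have cNf : continuous (fun x : rooted_space R => - f x).
  by move=> x; exact: (cvgN (cf x)).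
have NfM x : `|- f x| <= M by rewrite normrN.
have Nfd : local_modulus (fun x => - f x) d h.
  by move=> b x /fd; rewrite -opprD normrN.
have := Rintegral_limit_perm_le cNf NfM Nfd.
have -> : window_mean (fun x => - f x) h = - window_mean f h.
  by rewrite /window_mean sumrN mulNr.
have -> : \int[@unit_law R]_x (- f (limit_perm x)) =
    - \int[@unit_law R]_x f (limit_perm x).
  under eq_Rintegral do rewrite -mulN1r.
  rewrite RintegralZl ?mulN1r//.
  apply: (@bounded_integrable _ _ _ _ _ M) => //.
  apply: (measurableT_comp (continuous_measurable_borel cf)).
  exact: measurable_limit_perm.
by move: H1; rewrite ler_norml; lra.
Qed.

Definition limit_law : weak_prob R (rooted_space R) :=
  distribution (@unit_law R)
    (@limit_perm R : {RV (@unit_law R) >-> borel (rooted_space R)}).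

Lemma weak_eval_limit_law (f : bounded_continuous R (rooted_space R)) :
  weak_eval limit_law f = \int[@unit_law R]_x f (limit_perm x).
Proof.
have [M fM] := bc_bounded f; have cf := @bc_continuous _ _ f.
rewrite /weak_eval /limit_law /Rintegral; congr fine.
rewrite integral_distribution//.
  by apply/measurable_EFinP; exact: continuous_measurable_borel.
apply: (@bounded_integrable _ _ _ _ _ M) => //=.
apply: (measurableT_comp (continuous_measurable_borel cf)).
exact: measurable_limit_perm.
Qed.

(** The measure [root_law] displayed as a scaled sum of Dirac masses, a form to which the
    integration rules apply. *)
Definition root_mix (sigma : perms) :
    {measure set (borel (rooted_space R)) -> \bar R} :=
  mscale ((tag sigma).+1%:R^-1 : R)%:nng
    (msum (fun k => \d_(finite_rooted (tagged sigma) (inord k) :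
       borel (rooted_space R))) (tag sigma).+1).

Lemma ge0_integral_root_law (sigma : perms) (g : borel (rooted_space R) -> \bar R) :
  measurable_fun setT g -> (forall x, 0 <= g x)%E ->
  (\int[@root_law R sigma]_x g x = ((tag sigma).+1%:R^-1)%:E *
    \sum_(i < (tag sigma).+1) g (finite_rooted (tagged sigma) i))%E.
Proof.
move=> mg g0.
rewrite (eq_measure_integral (root_mix sigma)) => [|B mB _]; last first.
  rewrite /root_law /root_mix /mscale /= /msum; congr (_ * _)%E.
  by apply: eq_bigr => i _; rewrite inord_val.
rewrite ge0_integral_mscale//= ge0_integral_measure_sum//; congr (_ * _)%E.
apply: eq_bigr => i _; rewrite integral_dirac// diracT mul1e.
by rewrite inord_val.
Qed.

Lemma weak_eval_root_law (sigma : perms) (f : bounded_continuous R (rooted_space R)) :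
  weak_eval (@root_law R sigma : probability _ R) f =
  (\sum_(i < (tag sigma).+1) f (finite_rooted (tagged sigma) i)) / (tag sigma).+1%:R.
Proof.
have [M fM] := bc_bounded f; have cf := @bc_continuous _ _ f.
have mf := continuous_measurable_borel cf.
have M0 : 0 <= M by apply: le_trans (fM point).
have i1 := bounded_integrable (@root_law R sigma) mf fM.
have i2 : (@root_law R sigma).-integrable setT (EFin \o cst M).
  by apply: (@bounded_integrable _ _ _ _ _ M) => // x; rewrite ger0_norm.
rewrite /weak_eval.
(* Adding the bound [M] makes the integrand nonnegative, as [ge0_integral_root_law] requires. *)
transitivity (\int[@root_law R sigma]_x (f x + M) - M).
  by rewrite RintegralD// Rintegral_prob_cst addrK.
rewrite /Rintegral ge0_integral_root_law; last 2 first.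
  by apply/measurable_EFinP; apply: measurable_funD.
  by move=> x; rewrite lee_fin; have := fM x; rewrite ler_norml; lra.
rewrite sumEFin -EFinM /= big_split /= sumr_const card_ord mulrDr.
rewrite -[M *+ _]mulr_natl mulKf ?pnatr_eq0// addrK mulrC.
by [].
Qed.

End limit_law.

(** * Quenched convergence *)

Section quenched_convergence.
Variable R : realType.

Definition Av321_ratio n (B : set perms) : R :=
  #|[set s in Av321 n.+1 | to_perms s \in B]|%:R / #|Av321 n.+1|%:R.

Lemma Av321_ratio_ge0 n B : 0 <= Av321_ratio n B.
Proof. by rewrite divr_ge0. Qed.

Lemma le_Av321_ratio n (B C : set perms) : B `<=` C ->
  Av321_ratio n B <= Av321_ratio n C.
Proof.
move=> BC; rewrite ler_wpM2r ?invr_ge0// ler_nat; apply: subset_leq_card.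
apply/fintype.subsetP => s; rewrite !finset.inE => /andP[-> /set_mem sB] /=.
by apply/mem_set/BC.
Qed.

Lemma Av321_ratioU n (B C : set perms) :
  Av321_ratio n (B `|` C) <= Av321_ratio n B + Av321_ratio n C.
Proof.
rewrite -mulrDl ler_wpM2r ?invr_ge0// -natrD ler_nat -cardsUI.
apply: leq_trans (leq_addr _ _); apply: subset_leq_card.
apply/fintype.subsetP => s; rewrite !finset.inE => /andP[-> /set_mem] /=.
by case=> sB; apply/orP; [left|right]; exact: mem_set.
Qed.

Lemma Av321_ratio_set0 n : Av321_ratio n set0 = 0.
Proof.
rewrite /Av321_ratio (_ : finset _ = finset.set0) ?cards0 ?mul0r//.
by apply/setP => s; rewrite !finset.inE in_set0 andbF.
Qed.

(** The sets of measures that contain the quenched law with probability tending to 1. Convergence of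
    this filter is convergence in probability, stated without a metric for the weak topology. *)
Definition quenched_filter : set_system (weak_prob R (rooted_space R)) :=
  [set A | Av321_ratio n (~` (@quenched_law R @^-1` A)) @[n --> \oo] --> (0 : R)].

Instance quenched_filter_filter : Filter quenched_filter.
Proof.
split => [|A B FA FB|A B AB FA].
- rewrite /quenched_filter /= preimage_setT setCT.
  by under eq_fun do rewrite Av321_ratio_set0; exact: cvg_cst.
- have := cvgD FA FB; rewrite addr0 => /(_ _) FAB.
  apply: (squeeze_cvgr _ (cvg_cst 0) FAB); near=> n.
  by rewrite Av321_ratio_ge0 preimage_setI setCI Av321_ratioU.
- apply: (squeeze_cvgr _ (cvg_cst 0) FA); near=> n.
  rewrite Av321_ratio_ge0 le_Av321_ratio// => s /= nB As.
  exact/nB/AB.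
Unshelve. all: by end_near. Qed.

Lemma quenched_filter_eval (f : bounded_continuous R (rooted_space R)) (e : R) :
  0 < e -> quenched_filter
    [set mu | `|weak_eval mu f - weak_eval (limit_law R) f| < e].
Proof.
move=> e0; have [M fM] := bc_bounded f; have cf := @bc_continuous _ _ f.
have H := @average_concentration R f M (weak_eval (limit_law R) f) e fM.
have {}H := H _ e0; apply: (squeeze_cvgr _ (cvg_cst 0) (H _)).
  near=> n; rewrite Av321_ratio_ge0 /= ler_wpM2r ?invr_ge0// ler_nat.
  apply: subset_leq_card; apply/fintype.subsetP => s.
  rewrite !finset.inE => /andP[-> /set_mem /= H'] /=.
  move: H'; rewrite /quenched_law weak_eval_root_law /= => /negP.
  by rewrite -leNgt.
move=> d d0; have [h fh] := continuous_local_modulus cf d0.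
exists h; split => //; rewrite weak_eval_limit_law.
exact: (Rintegral_limit_perm cf fM fh).
Unshelve. all: by end_near. Qed.

(** The weak topology is initial for [weak_eval] into a product, so convergence is checked against
    one test function at a time. *)
Lemma quenched_filter_cvg : quenched_filter --> limit_law R.
Proof.
have evalE : (@weak_eval R (rooted_space R)) @ quenched_filter -->
    (weak_eval (limit_law R) : {ptws bounded_continuous R (rooted_space R) -> R}).
  apply/cvg_sup => f A [_ [[C Cop <-] Cf sC]].
  have /= : nbhs (weak_eval (limit_law R) f) C by exact: open_nbhs_nbhs.
  rewrite -nbhs_ballE => -[e /= e0 eC].
  change (quenched_filter (@weak_eval R (rooted_space R) @^-1` A)).
  apply: (@filterS _ quenched_filter _ _ _ _ (quenched_filter_eval f e0)) => mu /= mue.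
  apply: sC => /=.
  by apply: eC; rewrite /ball /= distrC.
move=> A [_ [[B Bop <-] Bfs sBfA]].
apply: (@filterS _ quenched_filter _ _ _ sBfA).
exact: (evalE B (open_nbhs_nbhs (conj Bop Bfs))).
Qed.

(** The difference is less than [e] off the bad event and at most [2 * M] on it; uniformity turns
    the probability of that event into [Av321_ratio]. *)
Lemma expectation_quenched (F : bounded_continuous R (weak_prob R (rooted_space R)))
    d (Omega : measurableType d) (P : probability Omega R)
    (sigma : {RV P >-> perms}) n (M e : R) :
  uniform_on P sigma (Av321 n.+1) -> (forall mu, `|F mu| <= M) -> 0 <= e ->
  'E_P[F \o (@quenched_law R \o sigma)]%E \is a fin_num /\
  `|F (limit_law R) - fine 'E_P[F \o (@quenched_law R \o sigma)]%E| <=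
  e + 2 * M * Av321_ratio n [set s | ~ `|F (limit_law R) - F (quenched_law R s)| < e].
Proof.
move=> unif FM e0; set l := F (limit_law R).
set B := [set s | ~ `|l - F (quenched_law R s)| < e].
have mF : measurable_fun [set: Omega] (fun w => F (quenched_law R (sigma w))).
  exact: (@measurableT_comp _ _ _ _ _ _ (fun s : perms => F (quenched_law R s))).
have iF : P.-integrable setT (EFin \o (fun w => F (quenched_law R (sigma w)))).
  exact: (bounded_integrable P mF (fun=> FM _)).
have il : P.-integrable setT (EFin \o (cst l)).
  by apply: (@bounded_integrable _ _ _ _ _ M) => // x; exact: FM.
rewrite unlock; split; first exact: integrable_fin_num.
have -> : fine (\int[P]_w ((F \o (@quenched_law R \o sigma)) w)%:E) =
  \int[P]_w F (quenched_law R (sigma w)) by [].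
rewrite -[X in X - _](Rintegral_prob_cst P l) -RintegralB//.
have mB : measurable (sigma @^-1` B) by rewrite -[_ @^-1` _]setTI; exact: measurable_funPT.
apply: (le_trans (le_normr_Rintegral measurableT (integrableB measurableT il iF))).
have ic : P.-integrable setT (EFin \o (cst e)).
  by apply: (@bounded_integrable _ _ _ _ _ e) => // x; rewrite ger0_norm.
have iB : P.-integrable setT (EFin \o (fun w => 2 * M * \1_(sigma @^-1` B) w)).
  exact: (integrableZl _ (2 * M) (integrable_indic P mB)).
apply: (@le_trans _ _ (\int[P]_w (e + 2 * M * \1_(sigma @^-1` B) w))).
  apply: le_Rintegral => //.
  - exact: (integrable_norm (integrableB measurableT il iF)).
  - exact: (integrableD measurableT ic iB).
  - move=> w _; have [Bw|Bw] := pselect (B (sigma w)).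
      rewrite indicE mem_set// mulr1; apply: ler_wpDl => //.
      apply: le_trans (ler_normB _ _) _.
      by rewrite mulrDl mul1r lerD// FM.
    rewrite indicE memNset// mulr0 addr0; apply: ltW; exact: contrapT.
rewrite RintegralD//.
rewrite Rintegral_prob_cst RintegralZl//; last exact: integrable_indic.
rewrite /Rintegral integral_indic// setIT.
by rewrite (_ : fine _ = Av321_ratio n B)//; exact: (congr1 fine (unif B)).
Qed.

Lemma expectation_quenched_cvg (F : bounded_continuous R (weak_prob R (rooted_space R)))
    (d : nat -> measure_display) (Omega : forall n, measurableType (d n))
    (P : forall n, probability (Omega n) R)
    (sigma : forall n, {RV P n >-> perms}) :
  (forall n, uniform_on (P n) (sigma n) (Av321 n.+1)) ->
  'E_(P n)[F \o (@quenched_law R \o sigma n)]%E @[n --> \oo] -->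
    (F (limit_law R))%:E.
Proof.
move=> unif; have [M FM] := bc_bounded F; have cF := @bc_continuous _ _ F.
have M0 : 0 <= M by apply: le_trans (FM (limit_law R)).
apply/fine_cvgP; split.
  by near=> n; have [] := expectation_quenched (unif n) FM ler01.
apply/cvgrPdist_le => e e0; have e2 : 0 < e / 2 by rewrite divr_gt0.
have Fcvg : F @ quenched_filter --> F (limit_law R).
  exact: cvg_comp quenched_filter_cvg (cF (limit_law R)).
pose B : set perms := [set s | ~ `|F (limit_law R) - F (quenched_law R s)| < e / 2].
have B0 : Av321_ratio n B @[n --> \oo] --> (0 : R).
  have FB : quenched_filter [set mu | `|F (limit_law R) - F mu| < e / 2].
    exact: (@cvgr_dist_lt _ _ _ quenched_filter _ _ _ Fcvg _ e2).
  exact: FB.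
(* The added 1 keeps the denominator positive when [M = 0]. *)
have eM : 0 < e / 2 / (2 * M + 1) by rewrite divr_gt0//; lra.
have /cvgrPdist_le/(_ _ eM) H := B0.
near=> n; have [_] := expectation_quenched (unif n) FM (ltW e2).
move=> /le_trans; apply; rewrite -/B.
have : `|0 - Av321_ratio n B| <= e / 2 / (2 * M + 1) by near: n.
rewrite sub0r normrN ger0_norm ?Av321_ratio_ge0// ler_pdivlMr; last by lra.
by have := Av321_ratio_ge0 n B; lra.
Unshelve. all: by end_near. Qed.

End quenched_convergence.

(* sigma n has size n + 1. *)
Theorem corollary5p5 (R : realType)
    (d : nat -> measure_display) (Omega : forall n, measurableType (d n))
    (P : forall n, probability (Omega n) R)
    (sigma : forall n, {RV P n >-> perms})
    (sigma_uniform : forall n, uniform_on (P n) (sigma n) (Av321 n.+1)) :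
  exists (d' : measure_display) (Omega' : measurableType d')
    (P' : probability Omega' R)
    (sigma_oo : {RV P' >-> borel (rooted_space R)}),
    (forall w, infinite_rooted (sigma_oo w)) /\
    quenched_BS_cvg P sigma P'
      (cst (distribution P' sigma_oo : borel (weak_prob R (rooted_space R)))
        : {RV P' >-> borel (weak_prob R (rooted_space R))}).
Proof.
exists _, (measurableTypeR R), (@unit_law R).
exists (@limit_perm R : {RV (@unit_law R) >-> borel (rooted_space R)}); split.
  by move=> w; exact: merge_perm_infinite.
move=> F; have := expectation_quenched_cvg (F := F) sigma_uniform.
by rewrite -(expectation_cst (@unit_law R) (F (limit_law R))).
Qed.
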